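(* Let $K$ be a real valued field of characteristic zero and let $f,g\in K\{x\}=K\{x_1,\dots,x_n\}$. If $f$ is contact equivalent to $g$, then $\mu(f)=\mu(g)$.
   Context: A real valued field is a field $K$ with a map $|\ |:K\to\mathbb{R}_{\ge 0}$ satisfying $|a|=0\Leftrightarrow a=0$, $|ab|=|a||b|$, $|a+b|\le|a|+|b|$ (the trivial valuation is allowed; $K$ need not be complete). For $x=(x_1,\dots,x_n)$, $K\{x\}\subseteq K[[x]]$ is the ring of convergent power series: those $f=\sum_\alpha c_\alpha x^\alpha$ for which $\sum_\alpha|c_\alpha|\varepsilon^\alpha<\infty$ for some $\varepsilon\in(\mathbb{R}_{>0})^n$. $f,g\in K\{x\}$ are contact equivalent if $f=u\cdot\varphi(g)$ for some automorphism $\varphi$ of the local $K$-algebra $K\{x\}$ and some unit $u\in K\{x\}^*$. The Milnor number is $\mu(f)=\dim_KK\{x\}/\langle\frac{\partial f}{\partial x_1},\dots,\frac{\partial f}{\partial x_n}\rangle\in\mathbb{N}\cup\{\infty\}$.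
   Formalization: The formal theorem also assumes f(0)=0 (so f and g are not units); without it the claim is false: for n=1, f=1+x is contact equivalent to g=1, but μ(f)=0 while μ(g) is infinite. *)

(* Defs.v *)
From HB Require Import structures.
From mathcomp Require Import all_boot all_order all_algebra.
From mathcomp Require Import boolp classical_sets functions cardinality fsbigop reals ereal esum.
(* The notations of mpoly clash with those of MathComp-Analysis.  We write
   multinom n for the type of exponents alpha in N^n, mnm0, mnm1 i and mnm_add
   for 0, the i-th unit vector and addition of exponents, mdeg for |alpha|, and
   bmultinom n d for the finite type of exponents of degree < d. *)
From mathcomp Require Import -(notations) mpoly.

Set Implicit Arguments.
Unset Strict Implicit.
Unset Printing Implicit Defensive.

Import Order.TTheory GRing.Theory Num.Theory.

Local Open Scope ring_scope.

Record absval (R : realType) (K : fieldType) := AbsVal {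
  absval_fun :> K -> R;
  absval_ge0 : forall a, 0 <= absval_fun a;
  absval_eq0 : forall a, absval_fun a = 0 <-> a = 0;
  absvalM : forall a b, absval_fun (a * b) = absval_fun a * absval_fun b;
  absvalD : forall a b, absval_fun (a + b) <= absval_fun a + absval_fun b
}.

Section AbsvalTheory.
Variables (R : realType) (K : fieldType) (v : absval R K).

Lemma absval0 : v 0 = 0.
Proof. by apply/absval_eq0. Qed.

Lemma absval1 : v 1 = 1.
Proof.
have v1 : v 1 != 0 by apply/eqP => /absval_eq0/eqP; rewrite oner_eq0.
by apply: (mulfI v1); rewrite -absvalM !mulr1.
Qed.

Lemma absvalMn a k : v (a *+ k) <= v a *+ k.
Proof.
elim: k => [|k IH]; first by rewrite !mulr0n absval0.
by rewrite !mulrS (le_trans (absvalD _ _ _))// lerD2l.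
Qed.

Lemma absval_sum (I : Type) (r : seq I) (P : pred I) (F : I -> K) :
  v (\sum_(i <- r | P i) F i) <= \sum_(i <- r | P i) v (F i).
Proof.
elim/big_rec2: _ => [|i y x _ yx]; first by rewrite absval0.
by rewrite (le_trans (absvalD _ _ _))// lerD2l.
Qed.

End AbsvalTheory.

(* The coefficient of x^alpha in f : fps K n is f alpha. *)
Definition fps (K : fieldType) (n : nat) := multinom n -> K.

HB.instance Definition _ (K : fieldType) n :=
  GRing.Lmodule.copy (fps K n) (multinom n -> K^o).

Section FpsRing.
Variables (K : fieldType) (n : nat).
Implicit Types (f g h : fps K n) (m : multinom n).

Definition fps1 : fps K n := fun m => (m == mnm0)%:R.

Definition fps_mul f g : fps K n := fun m =>
  \sum_(k : bmultinom n (mdeg m).+1 * bmultinom n (mdeg m).+1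
        | m == mnm_add k.1 k.2) f k.1 * g k.2.

Definition fps_trunc d f : mpoly n K :=
  \sum_(m : bmultinom n d) f m *: mpolyX K m.

Lemma fps_truncE d f m : (mdeg m < d)%N -> mcoeff m (fps_trunc d f) = f m.
Proof. exact: mcoeff_mpoly. Qed.

Lemma mcoeffM_eq (p q p' q' : mpoly n K) m :
    (forall k, (mdeg k <= mdeg m)%N -> mcoeff k p = mcoeff k p') ->
    (forall k, (mdeg k <= mdeg m)%N -> mcoeff k q = mcoeff k q') ->
  mcoeff m (p * q) = mcoeff m (p' * q').
Proof.
by move=> pp' qq'; rewrite !mcoeffM; apply: eq_bigr => -[[i ilt] [j jlt]] _ /=;
   rewrite pp' ?qq'.
Qed.

Lemma fps_mulE d f g m : (mdeg m < d)%N ->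
  fps_mul f g m = mcoeff m (fps_trunc d f * fps_trunc d g).
Proof.
move=> md; rewrite mcoeffM /fps_mul; apply: eq_bigr => -[[i ilt] [j jlt]] _ /=.
by rewrite !fps_truncE ?(leq_trans _ md).
Qed.

Lemma fps_mulA : associative fps_mul.
Proof.
move=> f g h; apply/funext => m.
rewrite !(@fps_mulE (mdeg m).+1)//.
transitivity (mcoeff m (fps_trunc (mdeg m).+1 f *
    (fps_trunc (mdeg m).+1 g * fps_trunc (mdeg m).+1 h))).
  apply: mcoeffM_eq => // k km; rewrite fps_truncE ?ltnS//.
  by rewrite (@fps_mulE (mdeg m).+1).
rewrite mulrA; apply: mcoeffM_eq => // k km; rewrite fps_truncE ?ltnS//.
by rewrite (@fps_mulE (mdeg m).+1).
Qed.

Lemma fps_mulC : commutative fps_mul.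
Proof.
by move=> f g; apply/funext => m; rewrite !(@fps_mulE (mdeg m).+1)// mulrC.
Qed.

Lemma fps_mul1 : left_id fps1 fps_mul.
Proof.
move=> f; apply/funext => m; rewrite (@fps_mulE (mdeg m).+1)//.
rewrite -(@fps_truncE (mdeg m).+1 f m)// -[in RHS](mul1r (fps_trunc _ _)).
apply: mcoeffM_eq => // k km; rewrite fps_truncE ?ltnS//.
by rewrite mcoeff1.
Qed.

Lemma fps_truncD d f g : fps_trunc d (f + g) = fps_trunc d f + fps_trunc d g.
Proof.
rewrite /fps_trunc -big_split; apply: eq_bigr => m _ /=.
by rewrite -scalerDl.
Qed.

Lemma fps_truncZ d a f : fps_trunc d (a *: f) = a *: fps_trunc d f.
Proof.
rewrite /fps_trunc scaler_sumr; apply: eq_bigr => m _ /=.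
by rewrite scalerA.
Qed.

Lemma fps_mulDl : left_distributive fps_mul +%R.
Proof.
move=> f g h; apply/funext => m.
rewrite -[RHS]/(fps_mul f h m + fps_mul g h m) !(@fps_mulE (mdeg m).+1)//.
by rewrite fps_truncD mulrDl mcoeffD.
Qed.

Lemma fps1_neq0 : fps1 != 0.
Proof.
apply/eqP => /(congr1 (@^~ mnm0)); rewrite /fps1 eqxx => /eqP.
by rewrite oner_eq0.
Qed.

HB.instance Definition _ := GRing.Zmodule_isComNzRing.Build (fps K n)
  fps_mulA fps_mulC fps_mul1 fps_mulDl fps1_neq0.

Lemma fps_scaleAl (a : K) f g : a *: (f * g) = (a *: f) * g.
Proof.
apply/funext => m; rewrite -[LHS]/(a * fps_mul f g m).
rewrite -[RHS]/(fps_mul (a *: f) g m) !(@fps_mulE (mdeg m).+1)//.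
by rewrite fps_truncZ -scalerAl mcoeffZ.
Qed.

HB.instance Definition _ :=
  GRing.Lmodule_isLalgebra.Build K (fps K n) fps_scaleAl.
HB.instance Definition _ := GRing.Lalgebra_isComAlgebra.Build K (fps K n).

Definition fps_deriv (i : 'I_n) f : fps K n :=
  fun m => f (mnm_add m (mnm1 i)) *+ (m i).+1.

End FpsRing.

Section Convergent.
Variables (R : realType) (K : fieldType) (v : absval R K) (n : nat).
Implicit Types (e : 'I_n -> R) (f g : fps K n) (m : multinom n).

(* epsilon^alpha *)
Definition mon e m : R := \prod_(i < n) e i ^+ m i.

Definition convergent_prop f : Prop := exists2 e : 'I_n -> R,
  forall i, 0 < e i &
  (\esum_(m in [set: multinom n]) (v (f m) * mon e m)%:E < +oo)%E.

Definition convergent : {pred fps K n} := [pred f | `[< convergent_prop f >]].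

Lemma mon_gt0 e m : (forall i, 0 < e i) -> 0 < mon e m.
Proof. by move=> e0; apply: prodr_gt0 => i _; rewrite exprn_gt0. Qed.

Lemma monD e m1 m2 : mon e (mnm_add m1 m2) = mon e m1 * mon e m2.
Proof. by rewrite -big_split; apply: eq_bigr => i _; rewrite mnmDE exprD. Qed.

Lemma le_mon e e' m : (forall i, 0 < e i <= e' i) -> mon e m <= mon e' m.
Proof.
move=> ee'; apply: ler_prod => i _; have /andP[e0 ei] := ee' i.
have e0' := lt_le_trans e0 ei.
by rewrite (exprn_ge0 _ (ltW e0))/= lerXn2r// nnegrE ltW.
Qed.

Lemma esum_fin_bounded (T : choiceType) (w : T -> R) : (forall x, 0 <= w x) ->
  (\esum_(x in [set: T]) (w x)%:E < +oo)%E <->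
  exists M : R, forall s : seq T, uniq s -> \sum_(x <- s) w x <= M.
Proof.
move=> w0; split=> [|[M sM]].
  rewrite -ge0_fin_numE; last by apply: esum_ge0 => x _; rewrite lee_fin.
  move=> /fineK sE; exists (fine (\esum_(x in [set: T]) (w x)%:E)) => s us.
  rewrite -lee_fin sE -sumEFin; apply: ereal_sup_ubound => /=.
  exists [set` s]%classic; last by rewrite -fsbig_seq.
  by split; [exact: finite_seq|exact: subsetT].
apply: (@le_lt_trans _ _ M%:E); last by rewrite ltry.
apply: ge_ereal_sup => _ [A [fA _] <-].
have [X AX] := finite_fsetP.1 fA.
rewrite AX -fsbig_seq ?finmap.fset_uniq// sumEFin lee_fin.
exact/sM/finmap.fset_uniq.
Qed.

Lemma convergentP f : reflect
  (exists e M, (forall i, 0 < e i) /\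
     forall s, uniq s -> \sum_(m <- s) v (f m) * mon e m <= M)
  (f \in convergent).
Proof.
have w0 e m : (forall i, 0 < e i) -> 0 <= v (f m) * mon e m.
  by move=> e0; rewrite mulr_ge0 ?absval_ge0 ?ltW ?mon_gt0.
apply: (iffP (asboolP _)) => [[e e0]|[e [M [e0 sM]]]].
  by move=> /esum_fin_bounded-/(_ (fun m => w0 e m e0))[M sM]; exists e, M.
exists e => //; apply/esum_fin_bounded => [m|]; first exact: w0.
by exists M.
Qed.

Lemma convergent_le e e' f M : (forall i, 0 < e i <= e' i) ->
  (forall s, uniq s -> \sum_(m <- s) v (f m) * mon e' m <= M) ->
  (forall s, uniq s -> \sum_(m <- s) v (f m) * mon e m <= M).
Proof.
move=> ee' sM s /sM; apply: le_trans; apply: ler_sum => m _.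
by rewrite ler_wpM2l ?absval_ge0 ?le_mon.
Qed.

Lemma convergent2 f g : f \in convergent -> g \in convergent ->
  exists e M N, [/\ forall i, 0 < e i,
    forall s, uniq s -> \sum_(m <- s) v (f m) * mon e m <= M &
    forall s, uniq s -> \sum_(m <- s) v (g m) * mon e m <= N].
Proof.
move=> /convergentP[e1 [M [e10 fM]]] /convergentP[e2 [N [e20 gN]]].
exists (fun i => Num.min (e1 i) (e2 i)), M, N; split.
- by move=> i; rewrite lt_min e10 e20.
- apply: convergent_le fM => i.
  by rewrite lt_min e10 e20 ge_min lexx.
- apply: convergent_le gN => i.
  by rewrite lt_min e10 e20 ge_min lexx orbT.
Qed.

Lemma fps_mul_bnd d f g m : (mdeg m < d)%N ->
  (f * g) m = \sum_(k : bmultinom n d * bmultinom n d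
                    | m == mnm_add k.1 k.2) f k.1 * g k.2.
Proof.
move=> md; rewrite -[LHS]/(fps_mul f g m) (fps_mulE _ _ md).
rewrite -[X in mcoeff _ X]/(mpoly_mul _ _) (mcoeff_poly_mul _ _ md).
by apply: eq_bigr => -[[i ilt] [j jlt]] _ /=; rewrite !fps_truncE.
Qed.

Lemma convergentD f g :
  f \in convergent -> g \in convergent -> f + g \in convergent.
Proof.
move=> cf cg; have [e [M [N [e0 fM gN]]]] := convergent2 cf cg.
apply/convergentP; exists e, (M + N); split=> // s us.
apply: le_trans (lerD (fM s us) (gN s us)); rewrite -big_split/=.
apply: ler_sum => m _; rewrite -mulrDl ler_wpM2r ?absvalD//.
by rewrite ltW ?mon_gt0.
Qed.

Lemma convergentZ a f : f \in convergent -> a *: f \in convergent.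
Proof.
move=> /convergentP[e [M [e0 fM]]]; apply/convergentP.
exists e, (v a * M); split=> // s us.
apply: le_trans (ler_wpM2l (absval_ge0 v a) (fM s us)); rewrite mulr_sumr.
by apply: ler_sum => m _; rewrite mulrA -absvalM.
Qed.

Lemma convergent1 : 1 \in convergent.
Proof.
apply/convergentP; exists (fun=> 1), 1; split=> // s us.
have E m : v ((1 : fps K n) m) * mon (fun=> 1) m = (m == mnm0)%:R.
  rewrite /mon big1 => [|i _]; last by rewrite expr1n.
  rewrite mulr1 -[(1 : fps K n) m]/((m == mnm0)%:R).
  by case: (m == mnm0); rewrite (absval0, absval1).
rewrite (eq_bigr _ (fun m _ => E m)) -natr_sum -[leRHS]/(1%:R) ler_nat.
have -> : (\sum_(m <- s) (m == mnm0) = count_mem mnm0 s)%N.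
  by rewrite -sum1_count [RHS]big_mkcond; apply: eq_bigr => m _ /=; case: eqP.
by rewrite count_uniq_mem // leq_b1.
Qed.

Lemma convergentM f g :
  f \in convergent -> g \in convergent -> f * g \in convergent.
Proof.
move=> cf cg; have [e [M [N [e0 fM gN]]]] := convergent2 cf cg.
have w0 h m : 0 <= v (h m) * mon e m.
  by rewrite mulr_ge0 ?absval_ge0 ?ltW ?mon_gt0.
have bM h L d : (forall s, uniq s -> \sum_(m <- s) v (h m) * mon e m <= L) ->
    \sum_(m : bmultinom n d) v (h m) * mon e m <= L.
  move=> hL; rewrite -(big_map (@bmnm n d) xpredT (fun m => v (h m) * mon e m)).
  by apply: hL; rewrite map_inj_uniq ?index_enum_uniq//; exact: val_inj.
apply/convergentP; exists e, (M * N); split=> // s us.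
pose d := (\max_(m <- s) mdeg m).+1.
have sd m : m \in s -> (mdeg m < d)%N.
  by move=> ms; rewrite ltnS; apply: leq_bigmax_seq.
have M0 : 0 <= M by have := fM [::] isT; rewrite big_nil.
apply: (@le_trans _ _ ((\sum_(m : bmultinom n d) v (f m) * mon e m) *
                      (\sum_(m : bmultinom n d) v (g m) * mon e m))); last first.
  by apply: ler_pM; rewrite ?sumr_ge0 ?bM.
pose F (k : bmultinom n d * bmultinom n d) :=
  (v (f k.1) * mon e k.1) * (v (g k.2) * mon e k.2).
have F0 k : 0 <= F k by rewrite mulr_ge0.
apply: (@le_trans _ _ (\sum_(m <- s)
    \sum_(k : bmultinom n d * bmultinom n d | m == mnm_add k.1 k.2) F k)).
  rewrite big_seq [leRHS]big_seq; apply: ler_sum => m /sd md.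
  rewrite (fps_mul_bnd f g md).
  apply: (@le_trans _ _ ((\sum_(k : bmultinom n d * bmultinom n d
      | m == mnm_add k.1 k.2) v (f k.1 * g k.2)) * mon e m)).
    by rewrite ler_wpM2r ?absval_sum// ltW ?mon_gt0.
  rewrite mulr_suml; apply: ler_sum => k /eqP ->.
  by rewrite absvalM monD /F mulrACA.
rewrite mulr_suml; under [leRHS]eq_bigr do rewrite mulr_sumr.
rewrite pair_big/= -/(F _) (exchange_big_dep xpredT)//=.
apply: ler_sum => k _.
rewrite -big_filter big_const_seq count_predT iter_addr_0 -/(F k).
rewrite -[leRHS]mulr1n ler_wpMn2l// size_filter.
rewrite (eq_count (a2 := pred1 (mnm_add k.1 k.2)))//.
by rewrite count_uniq_mem// leq_b1.
Qed.

Lemma convergent_deriv i f : f \in convergent -> fps_deriv i f \in convergent.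
Proof.
move=> /convergentP[e [M [e0 fM]]]; apply/convergentP.
exists (fun j => e j / 2), (M / e i); split=> [j|s us]; first by rewrite divr_gt0.
rewrite ler_pdivlMr// mulr_suml.
have us' : uniq [seq mnm_add m (mnm1 i) | m <- s].
  by rewrite map_inj_uniq// => m1 m2 /addIm.
apply: le_trans (fM _ us'); rewrite big_map; apply: ler_sum => m _.
have -> : mon (fun j => e j / 2) m = mon e m / 2 ^+ mdeg m.
  rewrite /mon (eq_bigr (fun j => e j ^+ m j * (2^-1) ^+ m j)); last first.
    by move=> j _; rewrite exprMn.
  rewrite big_split/= mdegE -exprVn; congr (_ * _).
  by rewrite -expr_sum.
rewrite monD.
have -> : mon e (mnm1 i) = e i.
  rewrite /mon (bigD1 i)//= big1 => [|j ji]; rewrite mnm1E ?eqxx ?expr1 ?mulr1//.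
  by rewrite eq_sym (negbTE ji) expr0.
rewrite [leRHS]mulrA ler_wpM2r ?(ltW (e0 i))//.
apply: (@le_trans _ _
    ((v (f (mnm_add m (mnm1 i))) *+ (m i).+1) * (mon e m / 2 ^+ mdeg m))).
  rewrite ler_wpM2r ?absvalMn// mulr_ge0 ?invr_ge0 ?exprn_ge0//.
  by rewrite ltW ?mon_gt0.
rewrite -(mulr_natr (v _)) mulrACA ler_piMr//.
  by rewrite mulr_ge0 ?absval_ge0 ?ltW ?mon_gt0.
rewrite ler_pdivrMr ?exprn_gt0// mul1r -natrX ler_nat.
apply: (leq_trans (ltn_expl (m i) (ltnSn 1))).
by rewrite leq_exp2l// mdegE (bigD1 i)//= leq_addr.
Qed.

End Convergent.

Arguments convergent {R K} v n.

Section ConvergentSubalg.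
Variables (R : realType) (K : fieldType) (v : absval R K) (n : nat).

Lemma convergent_subalg_closed : GRing.subalg_closed (convergent v n).
Proof.
split; first exact: convergent1.
  by move=> a f g cf cg; rewrite convergentD ?convergentZ.
exact: convergentM.
Qed.

HB.instance Definition _ :=
  GRing.isSubalgClosed.Build K (fps K n) (convergent v n)
    convergent_subalg_closed.

End ConvergentSubalg.

(* K{x_1, ..., x_n}, for the absolute value v on K *)
Record cps (R : realType) (K : fieldType) (v : absval R K) (n : nat) := Cps {
  cps_val :> fps K n;
  cps_valP : cps_val \in convergent v n
}.

Section CpsRing.
Variables (R : realType) (K : fieldType) (v : absval R K) (n : nat).
Implicit Types f g : cps v n.

HB.instance Definition _ := [isSub for @cps_val R K v n].
HB.instance Definition _ := [Choice of cps v n by <:].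
HB.instance Definition _ :=
  GRing.SubChoice_isSubComNzRing.Build (fps K n) (convergent v n) (cps v n)
    (GRing.subalg_closedBM (convergent_subalg_closed v n)).
HB.instance Definition _ := [SubZmodule_isSubLmodule of cps v n by <:].
HB.instance Definition _ :=
  [SubNzRing_SubLmodule_isSubLalgebra of cps v n by <:].
HB.instance Definition _ := [SubLalgebra_isSubAlgebra of cps v n by <:].

Definition cps_unit : {pred cps v n} := [pred f | `[< exists g, g * f = 1 >]].

Definition cps_inv f : cps v n :=
  if pselect (exists g, g * f = 1) is left ex then sval (cid ex) else f.

Fact cps_mulVr : {in cps_unit, left_inverse 1 cps_inv *%R}.
Proof.
move=> f /asboolP uf; rewrite /cps_inv; case: pselect => // ex.
by case: (cid ex).
Qed.

Fact cps_unitPl f g : g * f = 1 -> cps_unit f.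
Proof. by move=> gf; apply/asboolP; exists g. Qed.

Fact cps_invr_out : {in [predC cps_unit], cps_inv =1 id}.
Proof.
move=> f; rewrite !inE => /asboolP uf.
by rewrite /cps_inv; case: pselect.
Qed.

HB.instance Definition _ := GRing.ComNzRing_hasMulInverse.Build (cps v n)
  cps_mulVr cps_unitPl cps_invr_out.

Definition cps_deriv (i : 'I_n) f : cps v n :=
  Cps (convergent_deriv i (cps_valP f)).

End CpsRing.

Section Ideal.
Variables (K : fieldType) (A : comAlgType K) (I : finType).

Definition ideal_gen (s : I -> A) : {pred A} :=
  [pred h | `[< exists a : I -> A, h = \sum_i a i * s i >]].

Lemma ideal_gen_submod_closed s : GRing.submod_closed (ideal_gen s).
Proof.
split; first by apply/asboolP; exists (fun=> 0); rewrite big1// => i _; rewrite mul0r.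
move=> c _ _ /asboolP[a ->] /asboolP[b ->]; apply/asboolP.
exists (fun i => c *: a i + b i).
rewrite scaler_sumr -big_split; apply: eq_bigr => i _ /=.
by rewrite mulrDl scalerAl.
Qed.

HB.instance Definition _ s :=
  GRing.isSubmodClosed.Build K A (ideal_gen s) (ideal_gen_submod_closed s).

Lemma ideal_gen_scaler_closed s : GRing.scaler_closed (ideal_gen s).
Proof. exact: rpredZ. Qed.

End Ideal.

Section QuotLmod.
Variables (K : fieldType) (V : lmodType K) (W : zmodClosed V).
Variable scW : GRing.scaler_closed W.
Local Open Scope quotient_scope.

Definition quot_lmod of GRing.scaler_closed W : Type := Quotient.quot W.
Local Notation Q := (quot_lmod scW).

HB.instance Definition _ := GRing.Zmodule.on Q.

Definition quot_scale (a : K) (x : Q) : Q :=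
  \pi_(Quotient.quot W) (a *: repr (x : Quotient.quot W)).

Lemma pi_quot_scale a u : quot_scale a (\pi_(Quotient.quot W) u) =
  \pi_(Quotient.quot W) (a *: u).
Proof.
apply/eqP; rewrite -Quotient.idealrBE -scalerBr scW//.
by rewrite Quotient.idealrBE reprK.
Qed.

Lemma quot_lmodW (P : Q -> Prop) :
  (forall u : V, P (\pi_(Quotient.quot W) u)) -> forall x, P x.
Proof. by move=> Ppi; exact: quotW Ppi. Qed.

Fact quot_scaleA a b x : quot_scale a (quot_scale b x) = quot_scale (a * b) x.
Proof. by elim/quot_lmodW: x => u; rewrite !pi_quot_scale scalerA. Qed.

Fact quot_scale1 : left_id 1 quot_scale.
Proof. by elim/quot_lmodW => u; rewrite pi_quot_scale scale1r. Qed.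

Fact quot_scaleDr : right_distributive quot_scale +%R.
Proof.
move=> a; elim/quot_lmodW => u; elim/quot_lmodW => w.
by rewrite -[X in quot_scale a X]raddfD !pi_quot_scale scalerDr raddfD.
Qed.

Fact quot_scaleDl x : {morph quot_scale^~ x : a b / a + b}.
Proof.
by elim/quot_lmodW: x => u a b; rewrite !pi_quot_scale scalerDl raddfD.
Qed.

HB.instance Definition _ := GRing.Zmodule_isLmodule.Build K Q
  quot_scaleA quot_scale1 quot_scaleDr quot_scaleDl.

End QuotLmod.

Section Dimension.
Variables (K : fieldType) (V : lmodType K).

Definition is_basis d (b : 'I_d -> V) : Prop :=
  (forall c : 'I_d -> K, \sum_i c i *: b i = 0 -> forall i, c i = 0) /\
  (forall u : V, exists c : 'I_d -> K, u = \sum_i c i *: b i).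

(* None stands for an infinite dimension. *)
Definition dimension : option nat :=
  if pselect (exists d, exists b : 'I_d -> V, is_basis b) is left ex
  then Some (sval (cid ex)) else None.

Lemma is_basis_leq d e (b : 'I_d -> V) (b' : 'I_e -> V) :
  is_basis b -> is_basis b' -> (d <= e)%N.
Proof.
move=> [freeb genb] [_ genb'].
have [B bB] := choice (fun i => genb' (b i)).
have [C bC] := choice (fun j => genb (b' j)).
apply: (@mulmx1_min K d e (\matrix_(i, j) B i j) (\matrix_(j, i) C j i)).
apply/matrixP => i k; rewrite !mxE.
under eq_bigr do rewrite !mxE.
suff /freeb/(_ k)/eqP :
    \sum_l (\sum_j B i j * C j l - (i == l)%:R) *: b l = 0.
  by rewrite subr_eq0 => /eqP.
under eq_bigr do rewrite scalerBl.
have bi : \sum_l (i == l)%:R *: b l = b i.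
  rewrite (bigD1 i)//= eqxx scale1r big1 ?addr0// => l li.
  by rewrite eq_sym (negbTE li) scale0r.
rewrite sumrB bi.
apply/eqP; rewrite subr_eq0 [X in _ == X]bB; apply/eqP.
under eq_bigr do rewrite scaler_suml.
rewrite exchange_big; apply: eq_bigr => j _ /=.
by rewrite [in RHS]bC scaler_sumr; apply: eq_bigr => l _; rewrite scalerA.
Qed.

Lemma dimensionP d (b : 'I_d -> V) : is_basis b -> dimension = Some d.
Proof.
move=> bb; rewrite /dimension; case: pselect => [ex|[]]; last by exists d, b.
case: cid => e /= [b' bb']; congr Some.
by apply/eqP; rewrite eqn_leq !(is_basis_leq bb bb', is_basis_leq bb' bb).
Qed.

End Dimension.

Section Milnor.
Variables (R : realType) (K : fieldType) (v : absval R K) (n : nat).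
Implicit Types f g : cps v n.

Definition milnor_algebra f : lmodType K :=
  quot_lmod (@ideal_gen_scaler_closed K (cps v n) 'I_n
    (fun i => cps_deriv i f)).

Definition milnor_number f : option nat := dimension (milnor_algebra f).

(* An automorphism of a local ring preserves the maximal ideal, so that the
   automorphisms of the local K-algebra K{x} are its K-algebra automorphisms. *)
Definition contact_equivalent f g : Prop :=
  exists phi : {lrmorphism cps v n -> cps v n}, exists u : cps v n,
    [/\ bijective phi, u \is a GRing.unit & f = u * phi g].

End Milnor.

(* Main.v *)
Require Import Defs.
From HB Require Import structures.
From mathcomp Require Import all_boot all_order all_algebra.
From mathcomp Require Import boolp reals.
From mathcomp Require Import -(notations) mpoly ssrcomplements.
From mathcomp Require Import ring lra.

(* Write A = K{x}.  That mu (phi g) = mu g for an automorphism phi is the chain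
   rule.  For a unit u, d(u f) = u (df + f du/u), so that one has to compare the
   ideals J_s = (f_i + s w_i f) for s = 0 and s = 1, where f_i is the i-th partial
   derivative of f; by symmetry mu f <= mu (u f) is enough.

   Characteristic zero enters through one trace argument.  Let I be an ideal
   modulo which f is not a zero divisor, with B = A / (I + (f)) finite-dimensional
   and all f_i in I + (f).  Then A / (I + (f^2)) is free over K[z]/z^2, z acting
   as f, and comparing the coefficients of z in tr f = sum_i tr (f_i dx_i) gives
   dim B = 0 in K.  Saturating I, one concludes that f is nilpotent modulo J_1,
   so that mu (u f) is finite, and also modulo J_s over K[s], near x = s = 0.

   To compare dimensions, truncate and add multiples of x_i^(N+1) to f: the
   generators of J_s become polynomials x_i^N + (lower degree in x), and
   K[s][x] / J_s is free over K[s].  By the nilpotency, Q x_j^k is in J_s for some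
   Q with Q(0, 0) != 0, hence the ranks over K(s) of multiplication by Q and by
   the x_j^k add up to at most the dimension.  At s = 0 the former has rank at
   least mu f, at s = 1 the latter has corank at most mu (u f). *)

Set Implicit Arguments.
Unset Strict Implicit.
Unset Printing Implicit Defensive.

Import Order.TTheory GRing.Theory Num.Theory.

Local Open Scope ring_scope.

Local Notation xvar i := (mpolyX _ (mnm1 i)).

(** * Ideals and finite codimension *)

Record is_ideal (A : comNzRingType) (I : A -> Prop) : Prop := IsIdeal {
  ideal0 : I 0;
  idealD : forall g h, I g -> I h -> I (g + h);
  idealMl : forall a g, I g -> I (a * g)
}.

Section IdealTheory.
Variables (A : comNzRingType) (I : A -> Prop).
Hypothesis idI : is_ideal I.

Lemma idealMr a g : I g -> I (g * a).
Proof. by rewrite mulrC; exact: idealMl. Qed.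

Lemma idealN g : I g -> I (- g).
Proof. by move=> Ig; rewrite -mulN1r; apply: idealMl. Qed.

Lemma idealB g h : I g -> I h -> I (g - h).
Proof. by move=> Ig Ih; apply: idealD => //; exact: idealN. Qed.

Lemma ideal_sum (T : Type) (r : seq T) (P : pred T) (F : T -> A) :
  (forall i, P i -> I (F i)) -> I (\sum_(i <- r | P i) F i).
Proof. by move=> IF; elim/big_ind: _ => //; [exact: ideal0|exact: idealD]. Qed.

Lemma ideal_eq g h : I (g - h) -> I h -> I g.
Proof. by move=> Igh Ih; rewrite -(subrK h g); exact: idealD. Qed.

Lemma ideal_sub_trans h g k : I (g - h) -> I (h - k) -> I (g - k).
Proof. by move=> gh /(idealD idI gh); rewrite addrA subrK. Qed.

(** Multiplication by the adjugate of [M], as in Cramer's rule. This is the determinant trick behind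
    the Nakayama and Cayley-Hamilton arguments below. *)
Lemma ideal_det m (M : 'M[A]_m) (z : 'I_m -> A) :
  (forall i, I (\sum_j M i j * z j)) -> forall j, I (\det M * z j).
Proof.
move=> Mz j.
have -> : \det M * z j = \sum_i (\adj M) j i * \sum_k M i k * z k.
  transitivity (\sum_k (\adj M *m M) j k * z k).
    rewrite mul_adj_mx (bigD1 j)//= big1 ?addr0 => [|k kj].
      by rewrite mxE eqxx mulr1n.
    by rewrite mxE eq_sym (negbTE kj) mulr0n mul0r.
  under eq_bigr do rewrite mxE mulr_suml.
  rewrite exchange_big; apply: eq_bigr => i _ /=.
  by rewrite mulr_sumr; apply: eq_bigr => k _; rewrite mulrA.
by apply: ideal_sum => i _; apply: idealMl.
Qed.

End IdealTheory.

Section IdealSpan.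
Variables (A : comNzRingType) (n : nat).
Implicit Types s t : 'I_n -> A.

Definition ideal_span s (h : A) : Prop := exists a, h = \sum_i a i * s i.

Lemma ideal_span_ideal s : is_ideal (ideal_span s).
Proof.
split=> [|_ _ [a ->] [b ->]|c _ [a ->]].
- by exists (fun=> 0); rewrite big1// => i _; rewrite mul0r.
- by exists (fun i => a i + b i); rewrite -big_split; apply: eq_bigr => i _;
    rewrite mulrDl.
- by exists (fun i => c * a i); rewrite mulr_sumr; apply: eq_bigr => i _;
    rewrite mulrA.
Qed.

Lemma ideal_span_gen s i : ideal_span s (s i).
Proof.
exists (fun j => (j == i)%:R); rewrite (bigD1 i)//= eqxx mul1r big1 ?addr0//.
by move=> j ji; rewrite (negbTE ji) mul0r.
Qed.

Lemma ideal_span_sub s (I : A -> Prop) : is_ideal I -> (forall i, I (s i)) ->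
  forall h, ideal_span s h -> I h.
Proof.
by move=> idI Is _ [a ->]; apply: ideal_sum => // i _; apply: idealMl.
Qed.

End IdealSpan.

Section Codimension.
Variables (K : fieldType) (A : comNzRingType) (iota : {rmorphism K -> A}).
Implicit Types (W : A -> Prop).

Definition spans_mod W r (e : 'I_r -> A) :=
  forall g, exists c : 'I_r -> K, W (g - \sum_i iota (c i) * e i).

Definition free_mod W r (e : 'I_r -> A) :=
  forall c : 'I_r -> K, W (\sum_i iota (c i) * e i) -> forall i, c i = 0.

Lemma spans_mod_fin W (T : finType) (e : T -> A) :
  (forall g, exists c : T -> K, W (g - \sum_t iota (c t) * e t)) ->
  spans_mod W (fun i : 'I_#|T| => e (enum_val i)).
Proof.
move=> se g; have [c Wc] := se g; exists (fun i => c (enum_val i)).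
rewrite -(reindex (fun i : 'I_#|T| => enum_val i) (P := xpredT)
  (F := fun t => iota (c t) * e t))//.
exact/onW_bij/enum_val_bij.
Qed.

(** A relation modulo [W] with [c i != 0] expresses [e i] through the other generators, which
    therefore still span; induction on their number. *)
Lemma exists_basis_mod W m (e : 'I_m -> A) : is_ideal W -> spans_mod W e ->
  exists r (e' : 'I_r -> A), spans_mod W e' /\ free_mod W e'.
Proof.
move=> idW; elim: m e => [|m IH] e se.
  by exists 0%N, e; split=> // c _ [].
have [fe|/existsNP[c /not_implyP[Wc /existsNP[i /eqP ci]]]] :=
  pselect (free_mod W e); first by exists m.+1, e.
apply: (IH (e \o lift i)) => g; have [b Wb] := se g.
exists (fun j => b (lift i j) - b i * (c i)^-1 * c (lift i j)).
have := idealD idW Wb (idealMl idW (iota (b i * (c i)^-1)) Wc).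
have E (d : 'I_m.+1 -> K) : \sum_j iota (d j) * e j =
    iota (d i) * e i + \sum_j iota (d (lift i j)) * e (lift i j).
  exact: (bigD1_ord i).
rewrite (E c) (E b) => {E}; congr W.
apply/eqP; rewrite -subr_eq0; apply/eqP.
rewrite mulrDr mulrA -rmorphM mulfVK// mulr_sumr.
under [in X in _ - (_ - X)]eq_bigr do rewrite rmorphB mulrBl rmorphM -mulrA.
rewrite sumrB/=; ring.
Qed.

(** The matrix of coefficients of the [z i] on [e] has more rows than columns, so some nonzero row
    vector kills it. *)
Lemma dependent_mod W r (e : 'I_r -> A) m (z : 'I_m -> A) :
  is_ideal W -> spans_mod W e -> (r < m)%N ->
  exists2 c : 'I_m -> K, W (\sum_i iota (c i) * z i) & exists i, c i != 0.
Proof.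
move=> idW se rm; have [C zC] := choice (fun i => se (z i)).
pose M := \matrix_(i, j) C i j : 'M[K]_(m, r).
have : kermx M != 0.
  rewrite kermx_eq0 /row_free; apply: contraL rm => /eqP <-.
  by rewrite -leqNgt rank_leq_col.
case/rowV0Pn => u /sub_kermxP uM u0; exists (u 0).
  have -> : \sum_i iota (u 0 i) * z i =
      \sum_i iota (u 0 i) * (z i - \sum_j iota (C i j) * e j).
    under [RHS]eq_bigr do rewrite mulrBr; rewrite sumrB -[LHS]subr0.
    congr (_ - _); under eq_bigr do rewrite mulr_sumr.
    rewrite exchange_big big1// => j _ /=.
    under eq_bigr do rewrite mulrA -rmorphM.
    rewrite -mulr_suml -rmorph_sum/=.
    have /matrixP/(_ 0 j) := uM; rewrite !mxE => uMj.
    rewrite [X in iota X](_ : _ = 0) ?rmorph0 ?mul0r// -[RHS]uMj.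
    by apply: eq_bigr => i _; rewrite mxE.
  by apply: ideal_sum => // i _; apply: idealMl.
by case/rV0Pn: u0 => i; exists i.
Qed.

End Codimension.

(** * Traces over [K[z]/z^2] *)

(* [I1] and [I2] play the parts of I' + (f) and I' + (f^2) for an ideal I'
   modulo which f is not a zero divisor. *)
Section TraceLemma.
Variables (K : fieldType) (A : comNzRingType) (iota : {rmorphism K -> A}).
Variables (n : nat) (x : 'I_n -> A) (p : mpoly n K) (f : A).
Variables (I1 I2 : A -> Prop) (r : nat) (e : 'I_r -> A).
Hypotheses (idI1 : is_ideal I1) (idI2 : is_ideal I2).
Hypotheses (I2f : forall g, I2 (f * g) -> I1 g) (fI1 : forall g, I1 g -> I2 (f * g)).
Hypotheses (I1f : I1 f) (divf : forall h, I1 h -> exists b, I2 (h - f * b)).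
Hypotheses (spans_e : spans_mod iota I1 e) (free_e : free_mod iota I1 e).

Let I21 h : I2 h -> I1 h.
Proof. by move=> I2h; apply: I2f; apply: idealMl. Qed.

Let comb (c : 'I_r -> K) : A := \sum_i iota (c i) * e i.

Let combB c d : comb c - comb d = comb (fun i => c i - d i).
Proof.
by rewrite /comb -sumrB; apply: eq_bigr => i _; rewrite rmorphB mulrBl.
Qed.

(** Coordinates over [K[z]/z^2], with [z] acting as [f]: expand [g] modulo [I1], divide the
    remainder by [f], and expand the quotient modulo [I1]. *)
Let expand g : exists cd : ('I_r -> K) * ('I_r -> K),
  I2 (g - comb cd.1 - f * comb cd.2).
Proof.
have [c Ic] := spans_e g; have [b Ib] := divf Ic; have [d Id] := spans_e b.
exists (c, d) => /=; apply: (ideal_sub_trans idI2 Ib).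
by rewrite -mulrBr; apply: fI1.
Qed.

(** Modulo [I1] the multiple of [f] disappears, and freeness compares the first components; then
    [I2f] cancels [f] and freeness compares the second ones. *)
Let expand_uniq g c d c' d' : I2 (g - comb c - f * comb d) ->
  I2 (g - comb c' - f * comb d') -> c =1 c' /\ d =1 d'.
Proof.
move=> I2g I2g'.
have {I2g I2g'} : I2 (comb (fun i => c i - c' i) + f * comb (fun i => d i - d' i)).
  by have := idealB idI2 I2g' I2g; congr I2; rewrite -!combB; ring.
move=> I2cd.
have cc' : c =1 c'.
  move=> i; apply/eqP; rewrite -subr_eq0; apply/eqP; move: i.
  apply: free_e; rewrite -/(comb _).
  rewrite -[comb _](addrK (f * comb (fun i => d i - d' i))).
  by apply: idealB => //; [exact: I21|apply: idealMr].
split=> // i; apply/eqP; rewrite -subr_eq0; apply/eqP; move: i.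
apply: free_e; apply: I2f; move: I2cd; congr I2.
rewrite [X in X + _](_ : _ = 0) ?add0r// /comb big1// => i _.
by rewrite cc' subrr rmorph0 mul0r.
Qed.

(** Multiplication by [g] on [A / I2] has a matrix [a + z b] over [K[z]/z^2], whose row [j] holds
    the coordinates of [g * e j]. *)
Let mrep g : exists ab : 'M[K]_r * 'M[K]_r,
  forall j, I2 (g * e j - comb (ab.1 j) - f * comb (ab.2 j)).
Proof.
have [C CP] := choice (fun j => expand (g * e j)).
exists (\matrix_(i, j) (C i).1 j, \matrix_(i, j) (C i).2 j) => j /=.
move: (CP j); congr I2; congr (_ - _ - _ * _);
  by apply: eq_bigr => i _; rewrite mxE.
Qed.

Let ab g := projT1 (cid (mrep g)).
Let a g := (ab g).1.
Let b g := (ab g).2.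

Let abP g j : I2 (g * e j - comb (a g j) - f * comb (b g j)).
Proof. by rewrite /a /b /ab; case: cid. Qed.

Let ab_uniq g (M N : 'M[K]_r) :
  (forall j, I2 (g * e j - comb (M j) - f * comb (N j))) -> a g = M /\ b g = N.
Proof.
move=> MN; split; apply/matrixP => i j;
  by have [E F] := expand_uniq (abP g i) (MN i); rewrite ?E ?F.
Qed.

Let ab_eq g h : I2 (g - h) -> a g = a h /\ b g = b h.
Proof.
move=> gh; apply: ab_uniq => j.
have := idealD idI2 (idealMr idI2 (e j) gh) (abP h j); congr I2; ring.
Qed.

Let abD g h : a (g + h) = a g + a h /\ b (g + h) = b g + b h.
Proof.
apply: ab_uniq => j; have := idealD idI2 (abP g j) (abP h j); congr I2.
have E (M N : 'M[K]_r) : comb ((M + N) j) = comb (M j) + comb (N j).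
  by rewrite /comb -big_split; apply: eq_bigr => i _;
    rewrite mxE rmorphD mulrDl.
by rewrite !E; ring.
Qed.

(** The product of two matrices [a + z b] with [z^2 = 0]; the factors are reversed because
    coordinates are written in rows. *)
Let abM g h : a (g * h) = a h *m a g /\ b (g * h) = a h *m b g + b h *m a g.
Proof.
apply: ab_uniq => j.
have E (M N : 'M[K]_r) : comb ((M *m N) j) = \sum_k iota (M j k) * comb (N k).
  rewrite /comb; under [RHS]eq_bigr do rewrite mulr_sumr.
  rewrite exchange_big; apply: eq_bigr => k _ /=.
  rewrite mxE rmorph_sum mulr_suml; apply: eq_bigr => l _.
  by rewrite rmorphM mulrA.
have ED (M N : 'M[K]_r) : comb ((M + N) j) = comb (M j) + comb (N j).
  by rewrite /comb -big_split; apply: eq_bigr => i _;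
    rewrite mxE rmorphD mulrDl.
have H1 := idealMl idI2 g (abP h j).
have H2 : I2 (\sum_k iota (a h j k) *
    (g * e k - comb (a g k) - f * comb (b g k))).
  by apply: ideal_sum => // k _; apply: idealMl.
have H3 : I2 (\sum_k iota (b h j k) * (f *
    (g * e k - comb (a g k) - f * comb (b g k)))).
  by apply: ideal_sum => // k _; apply: idealMl => //; apply: idealMl.
(* This is the term in [z^2]: a multiple of [f] lies in [I1], so [f] times it lies in [I2]. *)
have H4 : I2 (f * (f * comb ((b h *m b g) j))).
  by apply: fI1; apply: idealMr.
have := idealD idI2 (idealD idI2 H1 H2) (idealD idI2 H3 H4); congr I2.
rewrite ED !E.
have -> : \sum_k iota (a h j k) * (g * e k - comb (a g k) - f * comb (b g k)) =
    g * comb (a h j) - \sum_k iota (a h j k) * comb (a g k)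
    - f * \sum_k iota (a h j k) * comb (b g k).
  rewrite [comb (a h j)]/comb !mulr_sumr -!sumrB; apply: eq_bigr => k _; ring.
have -> : \sum_k iota (b h j k) *
      (f * (g * e k - comb (a g k) - f * comb (b g k))) =
    g * f * comb (b h j) - f * \sum_k iota (b h j k) * comb (a g k)
    - f * (f * \sum_k iota (b h j k) * comb (b g k)).
  rewrite [comb (b h j)]/comb !mulr_sumr -!sumrB; apply: eq_bigr => k _; ring.
ring.
Qed.

Let comb_row (c : K) j : comb ((c%:M : 'M_r) j) = iota c * e j.
Proof.
rewrite /comb (bigD1 j)//= mxE eqxx mulr1n big1 ?addr0// => i ij.
by rewrite mxE eq_sym (negbTE ij) mulr0n rmorph0 mul0r.
Qed.

Let comb0 j : comb ((0 : 'M_r) j) = 0.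
Proof. by rewrite /comb big1// => i _; rewrite mxE rmorph0 mul0r. Qed.

Let ab_iota c : a (iota c) = c%:M /\ b (iota c) = 0.
Proof.
apply: ab_uniq => j; rewrite comb_row comb0 mulr0 subr0 subrr; exact: ideal0.
Qed.

(** Modulo [I2] such a [g] is a multiple of [f], so its matrix is a multiple of [z]. *)
Let a_I1 g : I1 g -> a g = 0.
Proof.
move=> I1g; have [c I2c] := divf I1g.
have [d dP] := choice (fun j => spans_e (c * e j)).
have := @ab_uniq g 0 (\matrix_(i, j) d i j); case=> // j.
rewrite comb0 subr0.
have -> : comb ((\matrix_(i, j) d i j) j) = \sum_i iota (d j i) * e i.
  by apply: eq_bigr => i _; rewrite mxE.
have := idealD idI2 (idealMr idI2 (e j) I2c) (fI1 (dP j)).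
congr I2; ring.
Qed.

Let b_f : b f = 1%:M.
Proof.
have [|//] := @ab_uniq f 0 1%:M => j.
by rewrite comb0 comb_row rmorph1 mul1r subr0 subrr; apply: ideal0.
Qed.

(* beta q g stands for the trace of q dg *)
Let beta q g := \tr (a q *m b g).

(** The Leibniz rule [q d(gh) = qg dh + qh dg] under the trace; cyclicity of the trace brings the
    factors of [abM] into the required order. *)
Let betaM q g h : beta q (g * h) = beta (q * g) h + beta (q * h) g.
Proof.
rewrite /beta (abM g h).2 mulmxDr mxtraceD addrC; congr (_ + _).
  by rewrite mulmxA (mxtrace_mulC _ (a g)) mulmxA (abM q g).1.
by rewrite mulmxA [in RHS]mulrC (abM h q).1.
Qed.

Let betaDr q g h : beta q (g + h) = beta q g + beta q h.
Proof. by rewrite /beta (abD g h).2 mulmxDr mxtraceD. Qed.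

Let betaDl q q' g : beta (q + q') g = beta q g + beta q' g.
Proof. by rewrite /beta (abD q q').1 mulmxDl mxtraceD. Qed.

Let beta0 g : beta 0 g = 0.
Proof. by rewrite /beta a_I1 ?mul0mx ?mxtrace0//; exact: ideal0. Qed.

Let beta_iota q c : beta q (iota c) = 0.
Proof. by rewrite /beta (ab_iota c).2 mulmx0 mxtrace0. Qed.

Let chain_prop g (dg : 'I_n -> A) :=
  forall q, beta q g = \sum_i beta (q * dg i) (x i).

Let ev : mpoly n K -> A := mmap iota x.

Let chainM P Q : chain_prop (ev P) (fun i => ev (mderiv i P)) ->
  chain_prop (ev Q) (fun i => ev (mderiv i Q)) ->
  chain_prop (ev (P * Q)) (fun i => ev (mderiv i (P * Q))).
Proof.
move=> cP cQ q; rewrite /ev rmorphM/= betaM cP cQ -big_split.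
apply: eq_bigr => i _ /=; rewrite -betaDl mderivM rmorphD !rmorphM/=.
by congr beta; ring.
Qed.

Let chainZ c P : chain_prop (ev P) (fun i => ev (mderiv i P)) ->
  chain_prop (ev (c *: P)) (fun i => ev (mderiv i (c *: P))).
Proof.
move=> cP q; rewrite /ev mmapZ betaM beta_iota addr0 cP.
apply: eq_bigr => i _; rewrite mderivZ mmapZ; congr beta; ring.
Qed.

Let chain1 : chain_prop (ev 1) (fun i => ev (mderiv i 1)).
Proof.
move=> q; rewrite /ev rmorph1 -(rmorph1 iota) beta_iota big1// => i _.
by rewrite -mpolyC1 mderivC rmorph0 mulr0 beta0.
Qed.

Let chainX i : chain_prop (ev (mpolyX K (mnm1 i)))
  (fun j => ev (mderiv j (mpolyX K (mnm1 i)))).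
Proof.
move=> q; rewrite /ev mmapX mmap1U.
rewrite (bigD1 i)//= big1 ?addr0 => [|j ji].
  rewrite mderivX mnm1E eqxx scale1r.
  have -> : mnm_sub (mnm1 i) (mnm1 i) = mnm0 :> multinom n.
    by apply/mnmP => j; rewrite mnmBE mnm0E subnn.
  by rewrite mpolyX0 rmorph1 mulr1.
by rewrite mderivX mnm1E eq_sym (negbTE ji) scale0r rmorph0 mulr0 beta0.
Qed.

Let chain P : chain_prop (ev P) (fun i => ev (mderiv i P)).
Proof.
elim/mpolyind: P => [|c m P _ _ IH].
  rewrite -(scale0r 1); exact/chainZ/chain1.
have cX : chain_prop (ev (mpolyX K m)) (fun i => ev (mderiv i (mpolyX K m))).
  rewrite mpolyXE_id; elim/big_rec: _ => [|i Q _ cQ]; first exact: chain1.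
  apply: chainM => //; elim: (m i) => [|k IHk]; first exact: chain1.
  by rewrite exprS; apply: chainM => //; exact: chainX.
move=> q; rewrite {1}/ev rmorphD betaDr IH (chainZ c cX) -big_split.
by apply: eq_bigr => i _ /=; rewrite -betaDl -mulrDr /ev mderivD rmorphD.
Qed.

(** The matrix of [f] is [z] times the identity, so [beta 1 f] is [r]. By the chain rule it is also
    the sum of the traces of [f_i dx_i], which vanish because the [f_i] lie in [I1]. *)
Lemma codim_eq0_of_deriv : I2 (f - mmap iota x p) ->
  (forall i, I1 (mmap iota x (mderiv i p))) -> r%:R = 0 :> K.
Proof.
move=> I2p I1p; rewrite -(mxtrace1 K r).
have -> : \tr (1%:M : 'M[K]_r) = beta 1 f.
  by rewrite /beta b_f mulmx1 -(rmorph1 iota) (ab_iota 1).1.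
rewrite /beta (ab_eq I2p).2 -/(beta _ _) -/(ev p) chain big1// => i _.
by rewrite mul1r /beta a_I1// mul0mx mxtrace0.
Qed.

End TraceLemma.

(** * Saturation *)

Lemma poly_factorX (R : nzRingType) (P : {poly R}) : P != 0 ->
  exists k c Q, c != 0 /\ P = (Q * 'X + c%:P) * 'X^k.
Proof.
elim/poly_ind: P => [|P c IH]; first by rewrite eqxx.
have [-> |c0 _] := eqVneq c 0; last by exists 0%N, c, P; rewrite expr0 mulr1.
rewrite addr0 => PX0; have {}/IH[k [d [Q [d0 ->]]]] : P != 0.
  by apply: contraNneq PX0 => ->; rewrite mul0r.
by exists k.+1, d, Q; rewrite exprSr mulrA.
Qed.

(** The powers [1, z, ..., z^r] are dependent modulo [W]. Dividing the relation by its lowest power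
    of [z] leaves a factor with nonzero constant term [c], which is a unit if [z] lies in the
    maximal ideal of a local ring. *)
Lemma exists_power_unit_mod (K : fieldType) (A : comNzRingType)
    (iota : {rmorphism K -> A}) (W : A -> Prop) r (e : 'I_r -> A) (z : A) :
  is_ideal W -> spans_mod iota W e ->
  exists k c y, c != 0 /\ W (z ^+ k * (y * z + iota c)).
Proof.
move=> idW se.
have [c Wc [i ci]] := dependent_mod (fun i : 'I_r.+1 => z ^+ i) idW se (ltnSn r).
pose P := \poly_(i < r.+1) c (inord i).
have P0 : P != 0.
  apply: contra_neq ci => /(congr1 (fun Q : {poly K} => Q`_i)).
  by rewrite coef_poly ltn_ord inord_val coef0.
have [k [d [Q [d0 PE]]]] := poly_factorX P0.
exists k, d, (map_poly iota Q).[z]; split=> //.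
rewrite (_ : _ * _ = (map_poly iota P).[z]).
  apply: eq_ind Wc _ _; rewrite [P]poly_def rmorph_sum horner_sum.
  apply: eq_bigr => j _; rewrite /= map_polyZ map_polyXn hornerZ hornerXn.
  by rewrite inord_val.
rewrite PE rmorphM rmorphD rmorphM/= map_polyXn map_polyX map_polyC/=.
by rewrite hornerM hornerXn hornerMXaddC mulrC.
Qed.

Section IdealAddGenerator.
Variables (A : comNzRingType) (I : A -> Prop) (f : A).
Hypothesis idI : is_ideal I.

Definition ideal_add g := exists b, I (g - b * f).

Lemma ideal_add_ideal : is_ideal ideal_add.
Proof.
split=> [|g h [b Ig] [c Ih]|a g [b Ig]].
- by exists 0; rewrite mul0r subr0; apply: ideal0.
- by exists (b + c); have := idealD idI Ig Ih; congr I; ring.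
- by exists (a * b); have := idealMl idI a Ig; congr I; ring.
Qed.

Lemma ideal_add_sub g : I g -> ideal_add g.
Proof. by exists 0; rewrite mul0r subr0. Qed.

Lemma ideal_add_gen : ideal_add f.
Proof. by exists 1; rewrite mul1r subrr; apply: ideal0. Qed.

(** Modulo [I], [z] is a multiple [b * f], so [z ^+ M] is congruent to [b ^+ M * f ^+ M]. *)
Lemma ideal_add_exp q z M : ideal_add z -> I (q * f ^+ M) -> I (q * z ^+ M).
Proof.
move=> [b Iz] If; have := idealMl idI (b ^+ M) If.
rewrite mulrCA -exprMn; apply: ideal_eq => //.
by rewrite -mulrBr subrXX; apply: idealMl => //; apply: idealMr.
Qed.

End IdealAddGenerator.

Section Saturation.
Variables (A : comNzRingType) (S I : A -> Prop) (f : A).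
Hypotheses (S1 : S 1) (SM : forall q q', S q -> S q' -> S (q * q')).
Hypothesis idI : is_ideal I.

(* For k = 1, 2 these are the S-saturations of I' + (f^k), where I' is the
   saturation of I with respect to S and f. *)
Definition sat_ideal k (g : A) : Prop :=
  exists q M b, S q /\ I (f ^+ M * (q * g + b * f ^+ k)).

Lemma sat_ideal_ideal k : is_ideal (sat_ideal k).
Proof.
split=> [|g h [q [M [b [Sq Ig]]]] [q' [M' [b' [Sq' Ih]]]]|c g [q [M [b [Sq Ig]]]]].
- by exists 1, 0%N, 0; split=> //; rewrite mulr0 mul0r addr0 mulr0; apply: ideal0.
- exists (q * q'), (M + M')%N, (q' * b + q * b'); split; first exact: SM.
  have := idealD idI (idealMl idI (f ^+ M' * q') Ig)
                     (idealMl idI (f ^+ M * q) Ih).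
  by rewrite exprD; congr I; ring.
- exists q, M, (c * b); split=> //; have := idealMl idI c Ig; congr I; ring.
Qed.

Lemma sat_ideal_sub k g : I g -> sat_ideal k g.
Proof.
by move=> Ig; exists 1, 0%N, 0; split=> //;
   rewrite mul1r mul0r addr0 expr0 mul1r.
Qed.

Lemma ideal_add_sat g : ideal_add I f g -> sat_ideal 1 g.
Proof.
by move=> [b Ig]; exists 1, 0%N, (- b); split=> //; move: Ig; congr I; ring.
Qed.

Lemma sat_ideal_gen k : sat_ideal k (f ^+ k).
Proof.
exists 1, 0%N, (- 1); split=> //.
by rewrite mulN1r mul1r subrr mulr0; apply: ideal0.
Qed.

Lemma sat_idealS q k g : S q -> sat_ideal k (q * g) -> sat_ideal k g.
Proof.
move=> Sq [q' [M [b [Sq' Ig]]]]; exists (q' * q), M, b.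
by split; [exact: SM|rewrite -mulrA].
Qed.

Lemma sat_ideal_sat k M g : I (f ^+ M * g) -> sat_ideal k g.
Proof.
by move=> Ig; exists 1, M, 0; rewrite mul1r mul0r addr0.
Qed.

Lemma sat_ideal2_div g : sat_ideal 2 (f * g) -> sat_ideal 1 g.
Proof.
move=> [q [M [b [Sq Ig]]]]; exists q, M.+1, b; split=> //.
by move: Ig; rewrite (exprSr f M); congr I; ring.
Qed.

Lemma sat_ideal2_mul g : sat_ideal 1 g -> sat_ideal 2 (f * g).
Proof.
move=> [q [M [b [Sq Ig]]]]; exists q, M, b; split=> //.
by have := idealMl idI f Ig; congr I; ring.
Qed.

(** Up to factors in [S] and powers of [f], both [g] and [h] are multiples of [f], so their product
    is a multiple of [f ^+ 2]. *)
Lemma sat_ideal_mul1 g h : sat_ideal 1 g -> sat_ideal 1 h -> sat_ideal 2 (g * h).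
Proof.
move=> [q [M [b [Sq Ig]]]] [q' [M' [b' [Sq' Ih]]]].
exists (q * q'), (M + M')%N, (- (b * b')); split; first exact: SM.
have := idealD idI (idealMl idI (f ^+ M' * q' * h) Ig)
                   (idealMl idI (- f ^+ M * b * f) Ih).
by rewrite exprD; congr I; ring.
Qed.

Variables (K : fieldType) (iota : {rmorphism K -> A}).
Variables (r : nat) (e : 'I_r -> A).
Hypothesis spans_e : spans_mod iota (sat_ideal 1) e.

Let id1 := sat_ideal_ideal 1.
Let id2 := sat_ideal_ideal 2.

(* q acts injectively, hence invertibly, on the finite-dimensional algebra
   A / I1; its inverse is lifted to A / I2 by a Newton step. *)
Lemma sat_ideal_inv q : S q -> exists q', sat_ideal 2 (q * q' - 1).
Proof.
move=> Sq.
suff [q' I1q] : exists q', sat_ideal 1 (q * q' - 1).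
  exists (q' *+ 2 - q * q' ^+ 2).
  have := idealN id2 (sat_ideal_mul1 I1q I1q); congr sat_ideal; ring.
have [k [d [y [d0 I1P]]]] := exists_power_unit_mod q id1 spans_e.
have Sqk m : S (q ^+ m) by elim: m => [|m IH]; rewrite ?exprS//; exact: SM.
move: (sat_idealS (Sqk k) I1P).
move=> /(idealMl id1 (- iota d^-1)) I1d.
exists (- iota d^-1 * y); move: I1d; congr sat_ideal.
have : iota d^-1 * iota d = 1 by rewrite -rmorphM mulVf// rmorph1.
by move=> dd; rewrite mulrDr [X in _ + X]mulNr dd; ring.
Qed.

(** Membership gives a multiple of [f] only for [q * h] with [q] in [S]; the inverse of [q] modulo
    the second ideal removes this factor. *)
Lemma sat_ideal1_div h : sat_ideal 1 h -> exists b, sat_ideal 2 (h - f * b).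
Proof.
move=> [q [M [b [Sq Ih]]]]; have [q' I2q] := sat_ideal_inv Sq.
have I2h : sat_ideal 2 (q * h + b * f) := sat_ideal_sat 2 Ih.
exists (- q' * b).
have := idealB id2 (idealMl id2 q' I2h) (idealMl id2 h I2q).
by congr sat_ideal; ring.
Qed.

Variables (n : nat) (x : 'I_n -> A) (p : mpoly n K).

(** The trace lemma makes the codimension of the first ideal zero in [K], hence zero as an integer
    in characteristic zero. So [1] lies in that ideal, and the conclusion unfolds this. *)
Lemma saturation_unit : [pchar K] =i pred0 ->
  sat_ideal 2 (f - mmap iota x p) ->
  (forall i, sat_ideal 1 (mmap iota x (mderiv i p))) ->
  exists q M b, S q /\ I (f ^+ M * (q + b * f)).
Proof.
move=> K0 I2p I1p; have [r' [e' [se' fe']]] := exists_basis_mod id1 spans_e.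
have I1f : sat_ideal 1 f := sat_ideal_gen 1.
have r0 : r' = 0%N.
  apply/eqP; rewrite -((pcharf0P K).1 K0); apply/eqP.
  exact: (@codim_eq0_of_deriv _ _ iota n x p f _ _ r' e' id1 id2 sat_ideal2_div
    sat_ideal2_mul I1f sat_ideal1_div se' fe').
have [c] := se' 1; rewrite big1 ?subr0 => [|[j jr] _]; last first.
  by exfalso; move: jr; rewrite r0.
by move=> [q [M [b [Sq Ib]]]]; exists q, M, b; rewrite mulr1 in Ib.
Qed.

End Saturation.

(** * A normal form *)

Section Degree.
Variables (n : nat) (R : comNzRingType).
Implicit Types (g h : mpoly n R) (m : multinom n).

(** The bound is strict so that [deg_lt 0] leaves only the zero polynomial, the base case of the
    inductions on the degree. *)
Definition deg_lt k g := forall m, (k <= mdeg m)%N -> mcoeff m g = 0.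

Lemma deg_lt_msize g : deg_lt (msize g) g.
Proof. by move=> m /msize_mdeg_ge/memN_msupp_eq0. Qed.

Lemma deg_lt_le k l g : (k <= l)%N -> deg_lt k g -> deg_lt l g.
Proof. by move=> kl gk m lm; apply: gk; apply: leq_trans lm. Qed.

Lemma deg_lt0 g : deg_lt 0 g -> g = 0.
Proof. by move=> g0; apply/mpolyP => m; rewrite mcoeff0 g0. Qed.

Lemma deg_ltD k g h : deg_lt k g -> deg_lt k h -> deg_lt k (g + h).
Proof. by move=> gk hk m km; rewrite mcoeffD gk ?hk ?addr0. Qed.

Lemma deg_ltZ k c g : deg_lt k g -> deg_lt k (c *: g).
Proof. by move=> gk m km; rewrite mcoeffZ gk ?mulr0. Qed.

Lemma deg_lt_sum k (T : Type) (r : seq T) (P : pred T) (F : T -> mpoly n R) :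
  (forall i, P i -> deg_lt k (F i)) -> deg_lt k (\sum_(i <- r | P i) F i).
Proof.
move=> Fk; elim/big_ind: _ => //; last exact: deg_ltD.
by move=> m _; rewrite mcoeff0.
Qed.

Lemma deg_ltM k l g h : deg_lt k.+1 g -> deg_lt l h -> deg_lt (k + l) (g * h).
Proof.
move=> gk hl m klm; rewrite mcoeffM big1// => -[[i ilt] [j jlt]] /= /eqP mE.
have [/gk->|ki] := leqP k.+1 (mdeg i); first by rewrite mul0r.
rewrite hl ?mulr0// -(leq_add2l k); apply: (leq_trans klm).
by rewrite mE mdegD leq_add2r.
Qed.

Lemma deg_ltX m : deg_lt (mdeg m).+1 (mpolyX R m).
Proof.
by move=> m' mm'; rewrite mcoeffX; case: eqP mm' => // ->; rewrite ltnn.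
Qed.

(** Both polynomials have degree at most [k] and share their homogeneous part of degree [k]. *)
Definition same_top k g h := deg_lt k.+1 h /\ deg_lt k (g - h).

Lemma same_topM k l g h g' h' :
  same_top k g h -> same_top l g' h' -> same_top (k + l) (g * g') (h * h').
Proof.
move=> [hk ghk] [hl ghl]; split; first by rewrite -addnS; apply: deg_ltM.
have gl : deg_lt l.+1 g'.
  by rewrite -(subrK h' g'); apply: deg_ltD => //; apply: deg_lt_le ghl.
have -> : g * g' - h * h' = g' * (g - h) + h * (g' - h') by ring.
by apply: deg_ltD; [rewrite addnC|]; apply: deg_ltM.
Qed.

Lemma same_topX m : same_top (mdeg m) (mpolyX R m) (mpolyX R m).
Proof. by split; [exact: deg_ltX|move=> m' _; rewrite subrr mcoeff0]. Qed.

Lemma same_top1 : same_top 0 1 (1 : mpoly n R).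
Proof. by have := same_topX (@mnm0 n); rewrite mdeg0 mpolyX0. Qed.

Lemma same_top_exp k l g h : same_top k g h -> same_top (l * k) (g ^+ l) (h ^+ l).
Proof.
move=> gh; elim: l => [|l IH]; first exact: same_top1.
by rewrite !exprS mulSn; apply: same_topM.
Qed.

End Degree.

Section NormalForm.
Variables (n : nat) (R : comNzRingType) (N : nat) (at_ : 'I_n -> mpoly n R).
Hypotheses (N0 : (0 < N)%N).
Hypothesis at_top : forall i, deg_lt N (at_ i - xvar i ^+ N).

Let X (m : multinom n) := mpolyX R m.
Let rest (m : multinom n) : multinom n :=
  Multinom [tuple (m i %% N)%N | i < n].
Let theta m := X (rest m) * \prod_i at_ i ^+ (m i %/ N).

Let restE m i : rest m i = (m i %% N)%N.
Proof. by rewrite /rest mnmE. Qed.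

(** Dividing each exponent by [N] splits [x^m] into [x^(rest m)] and powers of the [x_i^N], and
    [at_ i] has leading form [x_i^N]. *)
Let same_top_theta m : same_top (mdeg m) (theta m) (X m).
Proof.
have -> : X m = X (rest m) * \prod_i (X (mnm1 i) ^+ N) ^+ (m i %/ N).
  rewrite /X (mpolyXE_id _ m) (mpolyXE_id _ (rest m)) -big_split.
  apply: eq_bigr => i _ /=; rewrite -exprM -exprD restE.
  by rewrite addnC mulnC -divn_eq.
have -> : mdeg m = (mdeg (rest m) + \sum_i (m i %/ N) * N)%N.
  rewrite !mdegE -big_split; apply: eq_bigr => i _ /=.
  by rewrite restE addnC -divn_eq.
apply: same_topM; first exact: same_topX.
elim/big_rec3: _ => [|i g k h _ gh]; first exact: same_top1.
apply: same_topM => //; apply: same_top_exp; split.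
  rewrite /X mpolyXn -[N in deg_lt N.+1](_ : mdeg (mnm_muln (mnm1 i) N) = N).
    exact: deg_ltX.
  by rewrite mdegMn mdeg1 mul1n.
exact: at_top.
Qed.

(* Theta sends x^(b + N c) to x^b \prod_i at_i^c_i, for b < N.  It is
   unitriangular with respect to the degree, hence bijective. *)
Let Theta (g : mpoly n R) := \sum_(m <- msupp g) mcoeff m g *: theta m.

Let ThetaE k g : (msize g <= k)%N ->
  Theta g = \sum_(m : bmultinom n k) mcoeff m g *: theta m.
Proof.
move=> gk; pose J : subFinType _ := bmultinom n k.
rewrite /Theta (ssrcomplements.big_mksub J) ?msupp_uniq//=; last first.
  by move=> m /msize_mdeg_lt /leq_trans; apply.
by rewrite big_rmcond //= => m /memN_msupp_eq0 ->; rewrite scale0r.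
Qed.

Let Theta_linear a g h : Theta (a *: g + h) = a *: Theta g + Theta h.
Proof.
pose k := maxn (msize (a *: g + h)) (maxn (msize g) (msize h)).
rewrite !(@ThetaE k) ?leq_max ?leqnn ?orbT// scaler_sumr -big_split.
by apply: eq_bigr => m _; rewrite mcoeffD mcoeffZ scalerDl scalerA.
Qed.

Let Theta0 : Theta 0 = 0.
Proof. by rewrite /Theta msupp0 big_nil. Qed.

Let ThetaD g h : Theta (g + h) = Theta g + Theta h.
Proof. by have := Theta_linear 1 g h; rewrite !scale1r. Qed.

Let ThetaZ a g : Theta (a *: g) = a *: Theta g.
Proof. by have := Theta_linear a g 0; rewrite !addr0 Theta0 addr0. Qed.

Let ThetaX m : Theta (X m) = theta m.
Proof. by rewrite /Theta msuppX big_seq1 mcoeffX eqxx scale1r. Qed.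

Let Theta_top k g : deg_lt k.+1 g -> deg_lt k (g - Theta g).
Proof.
move=> gk; rewrite {1}(mpolyE g) /Theta -sumrB; apply: deg_lt_sum => m _.
rewrite -scalerBr; have [km|mk] := ltnP k (mdeg m).
  by rewrite gk// scale0r => m' _; rewrite mcoeff0.
apply: deg_ltZ; rewrite -opprB -scaleN1r; apply: deg_ltZ.
exact: deg_lt_le mk (same_top_theta m).2.
Qed.

Let Theta_inj g : Theta g = 0 -> g = 0.
Proof.
move=> g0; have := @deg_lt_msize _ _ g; elim: (msize g) => [|k IH].
  exact: deg_lt0.
by move=> /Theta_top; rewrite g0 subr0.
Qed.

Let Theta_surj g : exists h, Theta h = g.
Proof.
have := @deg_lt_msize _ _ g; move: (msize g) => k; elim: k g => [|k IH] g gk.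
  by exists 0; rewrite (deg_lt0 gk).
have [h hE] := IH _ (Theta_top gk); exists (g + h).
by rewrite ThetaD hE addrC subrK.
Qed.

(** Adding [N] to [m i] keeps the remainder [rest m] and raises the quotient [m i %/ N] by one, that
    is, adds one factor [at_ i] to [theta m]. *)
Let Theta_mulX i g : Theta (X (mnm1 i) ^+ N * g) = at_ i * Theta g.
Proof.
elim/mpolyind: g => [|c m g _ _ IH]; first by rewrite mulr0 Theta0 mulr0.
rewrite mulrDr ThetaD IH -scalerAr ThetaZ /X mpolyXn -mpolyXD !ThetaX.
rewrite ThetaD mulrDr ThetaZ ThetaX -scalerAr; congr (_ *: _ + _).
rewrite /theta [in RHS]mulrCA; congr (_ * _).
  congr X; apply/mnmP => j; rewrite !restE mnmDE mulmnE mnm1E.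
  by case: eqP => _; rewrite ?mul1n ?modnDl ?mul0n.
rewrite (bigD1 i)//= [in RHS](bigD1 i)//= mulrA; congr (_ * _).
  by rewrite mnmDE mulmnE mnm1E eqxx mul1n divnDl ?dvdnn// divnn N0 exprS.
apply: eq_bigr => j ji; rewrite mnmDE mulmnE mnm1E eq_sym (negbTE ji).
by rewrite mul0n.
Qed.

Let D := #|{: {ffun 'I_n -> 'I_N}}|.
Let bexp (j : 'I_D) : multinom n := 
  Multinom [tuple (enum_val j i : nat) | i < n].

Let bexp_lt j i : (bexp j i < N)%N.
Proof. by rewrite /bexp mnmE ltn_ord. Qed.

Let bexp_inj : injective bexp.
Proof.
move=> j k jk; apply: enum_val_inj; apply/ffunP => i; apply: val_inj.
by have := congr1 (fun m : multinom n => m i) jk; rewrite /bexp !mnmE.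
Qed.

Let bexp_surj (m : multinom n) : (forall i, (m i < N)%N) -> exists j, m = bexp j.
Proof.
move=> mN; exists (enum_rank [ffun i => Ordinal (mN i)]).
by apply/mnmP => i; rewrite /bexp mnmE enum_rankK ffunE.
Qed.

Let theta_bexp j : theta (bexp j) = X (bexp j).
Proof.
rewrite /theta big1 ?mulr1 => [|i _]; last by rewrite divn_small ?expr0.
by congr X; apply/mnmP => i; rewrite restE modn_small.
Qed.

Let rep g := projT1 (cid (Theta_surj g)).

Let repK g : Theta (rep g) = g.
Proof. by rewrite /rep; case: cid. Qed.

Let rep_uniq g h : Theta h = g -> rep g = h.
Proof.
move=> hg; apply/eqP; rewrite -subr_eq0; apply/eqP; apply: Theta_inj.
by rewrite ThetaD -scaleN1r ThetaZ repK hg scaleN1r subrr.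
Qed.

(** [nf g] reads the coefficients of the preimage of [g] under [Theta] at the exponents with all
    entries below [N]. Multiples of [at_ i] come from multiples of [x_i^N], which have no such
    coefficients. Thus the quotient by [at_] is free over [R] on the monomials [b]. *)
Lemma normal_form : exists D (b : 'I_D -> mpoly n R) (nf : mpoly n R -> 'rV[R]_D),
  [/\ linear nf, forall i g, nf (at_ i * g) = 0,
      forall j, nf (b j) = delta_mx 0 j &
      forall g, ideal_span at_ (g - \sum_j nf g 0 j *: b j)].
Proof.
exists D, (fun j => X (bexp j)), (fun g => \row_j mcoeff (bexp j) (rep g)).
have idat := ideal_span_ideal at_.
split=> [a g h|i g|j|g].
- apply/rowP => j; rewrite !mxE -mcoeffZ -mcoeffD; congr mcoeff.
  by apply: rep_uniq; rewrite Theta_linear !repK.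
- apply/rowP => j; rewrite !mxE (rep_uniq (h := X (mnm1 i) ^+ N * rep g)).
    rewrite /X mpolyXn mulrC.
    rewrite mcoeffM big1// => -[[k klt] [l llt]] /= /eqP E.
    rewrite [X in _ * X]mcoeffX; case: eqP => [lE|]; last by rewrite mulr0.
    have := bexp_lt j i; rewrite E mnmDE -lE mulmnE mnm1E eqxx mul1n.
    by rewrite ltnNge leq_addl.
  by rewrite Theta_mulX repK.
- rewrite (rep_uniq (h := X (bexp j))) ?ThetaX//.
  by apply/rowP => k; rewrite !mxE /X mcoeffX (inj_eq bexp_inj) eq_sym.
- rewrite -{1}(repK g); under eq_bigr do rewrite mxE.
  elim/mpolyind: (rep g) => [|c m h _ _ IH].
    rewrite Theta0 big1 ?subrr; first exact: ideal0.
    by move=> j _; rewrite mcoeff0 scale0r.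
  rewrite ThetaD ThetaZ ThetaX.
  under eq_bigr do rewrite mcoeffD mcoeffZ scalerDl -scalerA.
  rewrite big_split -scaler_sumr /= opprD addrACA -scalerBr.
  apply: idealD => //; rewrite -mul_mpolyC; apply: idealMl => //.
  have [mN|] := pselect (forall i, (m i < N)%N).
    have [j ->] := bexp_surj mN; rewrite theta_bexp (bigD1 j)//= mcoeffX eqxx.
    rewrite scale1r big1 ?addr0 ?subrr; first exact: ideal0.
    move=> k kj; rewrite mcoeffX (inj_eq bexp_inj) eq_sym (negbTE kj).
    by rewrite scale0r.
  move=> /existsNP[i /negP]; rewrite -leqNgt => Nm.
  rewrite big1 ?subr0 => [|j _]; last first.
    rewrite mcoeffX; case: eqP => [E|]; last by rewrite scale0r.
    by have := bexp_lt j i; rewrite -E ltnNge Nm.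
  (* Here [N <= m i], so [theta m] contains a factor [at_ i]. *)
  rewrite /theta (bigD1 i)//= -[(m i %/ N)%N]prednK ?divn_gt0// exprS.
  rewrite mulrCA -!mulrA; apply: idealMr => //; exact: ideal_span_gen.
Qed.

End NormalForm.

(** * Specialization of the parameter *)

Section RankSpecialization.
Variable K : fieldType.

(** Specialization cannot raise the rank: constant matrices [L] and [M] that cut [Ga] down to an
    identity of size [r] give a matrix [H] whose determinant is [1] at [s = a], hence nonzero over
    [K(s)]. *)
Lemma leq_rank_horner_tofrac m D (G : 'M[{poly K}]_(m, D)) (a : K) :
  (\rank (map_mx (horner_eval a) G) <= \rank (map_mx (@tofrac {poly K}) G))%N.
Proof.
set Ga := map_mx _ G; set r := \rank Ga.
pose L : 'M_(r, m) := pid_mx r *m invmx (col_ebase Ga).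
pose M : 'M_(D, r) := invmx (row_ebase Ga) *m pid_mx r.
have LGM : L *m Ga *m M = 1%:M.
  rewrite -[in LHS](mulmx_ebase Ga) /L /M -/r !mulmxA mulmxKV ?col_ebase_unit//.
  rewrite mulmxK ?row_ebase_unit// !pid_mx_id ?rank_leq_row ?rank_leq_col//.
  exact: pid_mx_1.
pose H := map_mx polyC L *m G *m map_mx polyC M.
have detH : \det H != 0.
  have : horner_eval a (\det H) = 1.
    have evC m' n' (B : 'M_(m', n')) : map_mx (horner_eval a) (map_mx polyC B) = B.
      by apply/matrixP => i j; rewrite !mxE /horner_eval hornerC.
    by rewrite -det_map_mx !map_mxM/= !evC LGM det1.
  by apply: contra_eqN => /eqP ->; rewrite raddf0 eq_sym oner_eq0.
have : \rank (map_mx (@tofrac {poly K}) H) = r.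
  apply: mxrank_unit; rewrite unitmxE det_map_mx unitfE.
  by rewrite tofrac_eq0.
rewrite !map_mxM/= => <-.
by apply: (leq_trans (mxrankM_maxl _ _)); apply: mxrankM_maxr.
Qed.

(** Both ranks are bounded by the ranks over [K(s)], where [G *m H = 0] applies; this allows two
    different points [a] and [b]. *)
Lemma leq_rank_add_horner m D D' (G : 'M[{poly K}]_(m, D)) (H : 'M_(D, D')) a b :
  G *m H = 0 ->
  (\rank (map_mx (horner_eval a) G) + \rank (map_mx (horner_eval b) H) <= D)%N.
Proof.
move=> GH; apply: leq_trans (leq_add (leq_rank_horner_tofrac G a)
  (leq_rank_horner_tofrac H b)) _.
by apply: mulmx0_rank_max; rewrite -map_mxM GH map_mx0.
Qed.

End RankSpecialization.

(* K[s][x] is {mpoly {poly K}[n]} and s is 'X. *)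
Section Family.
Variables (K : fieldType) (n : nat).

Local Notation P := (mpoly n {poly K}).

Definition spec (a : K) : P -> mpoly n K := map_mpoly (horner_eval a).
Definition lift_const : mpoly n K -> P := map_mpoly polyC.

HB.instance Definition _ a := GRing.RMorphism.on (spec a).
HB.instance Definition _ := GRing.RMorphism.on lift_const.

Lemma lift_constK a : cancel lift_const (spec a).
Proof.
move=> g; apply/mpolyP => m; rewrite !mcoeff_map_mpoly.
by rewrite /= /horner_eval hornerC.
Qed.

Lemma lift_constZ c g : lift_const (c *: g) = c%:P *: lift_const g.
Proof. by rewrite /lift_const map_mpolyZ. Qed.

Lemma spec0P a (g : P) : spec a g = 0 -> exists h, g = ('X - a%:P) *: h.
Proof.
move=> g0.
have dv m : {q | mcoeff m g = q * ('X - a%:P)}.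
  apply/sig_eqW/factor_theorem/eqP; rewrite -/(horner_eval a _).
  by rewrite -[LHS]mcoeff_map_mpoly [map_mpoly _ _]g0 mcoeff0.
pose k := msize g; exists (\sum_(m : bmultinom n k) projT1 (dv m) *: mpolyX _ m).
rewrite {1}(mpolywE (leqnn k)) scaler_sumr; apply: eq_bigr => m _.
by case: (dv m) => q /= ->; rewrite scalerA mulrC.
Qed.

Lemma spec_lift_const a (g : P) :
  exists h, g = lift_const (spec a g) + ('X - a%:P) *: h.
Proof.
have [|h hE] := @spec0P a (g - lift_const (spec a g)); last first.
  by exists h; rewrite -hE addrC subrK.
by rewrite raddfB/= lift_constK subrr.
Qed.

Variables (at_ : 'I_n -> P) (D : nat) (b : 'I_D -> P) (nf : P -> 'rV[{poly K}]_D).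
Hypothesis nf_linear : linear nf.
Hypothesis nf_at : forall i g, nf (at_ i * g) = 0.
Hypothesis nf_b : forall j, nf (b j) = delta_mx 0 j.
Hypothesis nf_span : forall g, ideal_span at_ (g - \sum_j nf g 0 j *: b j).

Let nf0 : nf 0 = 0.
Proof. by have := nf_linear (-1) 0 0; rewrite scaler0 addr0 scaleN1r addNr. Qed.

Let nfD g h : nf (g + h) = nf g + nf h.
Proof. by have := nf_linear 1 g h; rewrite !scale1r. Qed.

Let nfZ c g : nf (c *: g) = c *: nf g.
Proof. by have := nf_linear c g 0; rewrite nf0 !addr0. Qed.

Let nfB g h : nf (g - h) = nf g - nf h.
Proof. by rewrite nfD -scaleN1r nfZ scaleN1r. Qed.

Let nf_sum (J : finType) (F : J -> P) : nf (\sum_j F j) = \sum_j nf (F j).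
Proof. by elim/big_rec2: _ => [|j y z _ <-]; rewrite ?nfD. Qed.

Let nf_ideal g : ideal_span at_ g -> nf g = 0.
Proof.
move=> [h ->]; rewrite nf_sum big1// => i _.
by rewrite /= mulrC nf_at.
Qed.

(** Multiplication by [g] on the free [K[s]]-module [K[s][x]/(at_)], in the basis [b]. *)
Let Mat g : 'M[{poly K}]_D := \matrix_(i, j) nf (g * b i) 0 j.

Let nfM g h : nf (g * h) = nf h *m Mat g.
Proof.
have /nf_ideal : ideal_span at_ (g * (h - \sum_j nf h 0 j *: b j)).
  by apply: idealMl => //; exact: ideal_span_ideal.
rewrite mulrBr nfB => /eqP; rewrite subr_eq0 => /eqP ->.
rewrite mulr_sumr nf_sum; apply/rowP => j; rewrite summxE !mxE.
by apply: eq_bigr => i _; rewrite -scalerAr nfZ !mxE.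
Qed.

Let nu a g : 'rV[K]_D := map_mx (horner_eval a) (nf g).

Let nuD a g h : nu a (g + h) = nu a g + nu a h.
Proof. by rewrite /nu nfD map_mxD. Qed.

Let nuZ a c g : nu a (c *: g) = c.[a] *: nu a g.
Proof. by rewrite /nu nfZ map_mxZ. Qed.

Let nuM a g h : nu a (g * h) = nu a h *m map_mx (horner_eval a) (Mat g).
Proof. by rewrite /nu nfM map_mxM. Qed.

(** The two arguments differ by a multiple of [s - a], which [nu a] kills. *)
Let nu_spec a g : nu a (lift_const (spec a g)) = nu a g.
Proof.
have [h hE] := spec_lift_const a g; rewrite [in RHS]hE nuD nuZ.
by rewrite hornerXsubC subrr scale0r addr0.
Qed.

Let nu_sum a (I : finType) (F : I -> P) : nu a (\sum_i F i) = \sum_i nu a (F i).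
Proof. by rewrite /nu nf_sum raddf_sum. Qed.

Let nu_eq0 a g : nu a g = 0 -> ideal_span (spec a \o at_) (spec a g).
Proof.
move=> g0; have [h hE] := nf_span g; exists (spec a \o h).
have /(congr1 (spec a)) := hE.
rewrite rmorphB/= [spec a (\sum_j _)]rmorph_sum/= big1 ?subr0 => [->|j _].
  by rewrite rmorph_sum; apply: eq_bigr => i _; rewrite /= rmorphM.
rewrite /spec map_mpolyZ; have /rowP/(_ j) := g0; rewrite !mxE.
by move=> E; rewrite /= E scale0r.
Qed.

(** Modulo [at_] the [x_j^kk] kill [Q], so the rank of [Q] at [a] and that of all [x_j^kk] together
    at [a'] add up to at most [D]. Freeness makes the first at least [d0], and generation makes the
    second at least [D - d1]. *)
Lemma codim_leq (a a' : K) (Q : P) kk d0 d1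
    (e0 : 'I_d0 -> mpoly n K) (e1 : 'I_d1 -> mpoly n K) :
  (forall j, ideal_span at_ (Q * xvar j ^+ kk)) ->
  (forall c : 'I_d0 -> K,
     ideal_span (spec a \o at_) (spec a Q * \sum_i c i *: e0 i) -> forall i, c i = 0) ->
  (forall g, exists c : 'I_d1 -> K, exists t z, g = \sum_i c i *: e1 i +
     \sum_i t i * spec a' (at_ i) + \sum_i z i * xvar i ^+ kk) ->
  (d0 <= d1)%N.
Proof.
move=> QX free0 span1.
pose T : finType := ('I_n * 'I_D)%type.
(* [G] stacks the matrices of multiplication by all the [x_i^kk]. *)
pose G : 'M[{poly K}]_(#|{: T}|, D) :=
  \matrix_(i, j) nf (xvar (enum_val i).1 ^+ kk * b (enum_val i).2) 0 j.
have GQ : G *m Mat Q = 0.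
  apply/row_matrixP => i; rewrite row_mul row0.
  have -> : row i G = nf (xvar (enum_val i).1 ^+ kk * b (enum_val i).2).
    by apply/rowP => j; rewrite !mxE.
  rewrite -nfM nf_ideal// mulrA; apply: idealMr; first exact: ideal_span_ideal.
  exact: QX.
have leD := leq_rank_add_horner a' a GQ.
rewrite -(leq_add2l (\rank (map_mx (horner_eval a') G))).
apply: (@leq_trans D).
  apply: leq_trans leD; rewrite leq_add2l.
  (* The rows of [V] are the coordinates of the [e0 i]; by [free0] they stay independent after
     multiplication by [Q]. *)
  pose V : 'M_(d0, D) := \matrix_(i, j) nu a (lift_const (e0 i)) 0 j.
  apply: leq_trans (mxrankM_maxr V _).
  suff /eqP -> : row_free (V *m map_mx (horner_eval a) (Mat Q)) by [].
  apply/row_freeP/row_freeP; rewrite -kermx_eq0; apply/rowV0P => u /sub_kermxP.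
  rewrite mulmxA => uVQ; apply/rowP => i; rewrite mxE; move: i.
  apply: free0.
  have uV : u *m V = nu a (lift_const (\sum_i u 0 i *: e0 i)).
    rewrite raddf_sum nu_sum; apply/rowP => j; rewrite summxE !mxE.
    apply: eq_bigr => i _; rewrite /= lift_constZ nuZ hornerC.
    by rewrite !mxE.
  rewrite -(lift_constK a (\sum_i _)) -rmorphM.
  by apply: nu_eq0; rewrite nuM -uV.
rewrite addnC.
(* By [span1], the [d1] coordinate rows of the [e1 i] and the rows of [G] at [a'] span the whole
   space. *)
pose V : 'M_(d1, D) := \matrix_(i, j) nu a' (lift_const (e1 i)) 0 j.
apply: (@leq_trans (\rank (V + map_mx (horner_eval a') G)%MS)); last first.
  by apply: leq_trans (mxrank_adds_leqif _ _).1 _; rewrite leq_add2r rank_leq_row.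
rewrite -[D in (D <= _)%N](mxrank1 K); apply: mxrankS.
apply/row_subP => l; rewrite row1.
have -> : delta_mx 0 l = nu a' (b l).
  by rewrite /nu nf_b map_delta_mx.
rewrite -nu_spec; have [c [t [z ->]]] := span1 (spec a' (b l)).
rewrite !raddfD/= !nuD !raddf_sum/= !nu_sum.
have -> : \sum_i nu a' (lift_const (t i * spec a' (at_ i))) = 0.
  rewrite big1// => i _; rewrite -(nu_spec a' (lift_const _)) lift_constK.
  rewrite -(lift_constK a' (t i)) -rmorphM nu_spec mulrC.
  by rewrite /nu nf_at map_mx0.
rewrite addr0; apply: addmx_sub_adds; apply: summx_sub => i _.
  rewrite lift_constZ nuZ; apply: scalemx_sub.
  have -> : nu a' (lift_const (e1 i)) = row i V.
    by apply/rowP => j; rewrite !mxE.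
  exact: row_sub.
rewrite rmorphM rmorphXn/= [lift_const (mpolyX _ _)]map_mpolyX mulrC nuM.
rewrite [nu _ _]row_sum_delta mulmx_suml; apply: summx_sub => l' _.
rewrite -scalemxAl; apply: scalemx_sub; rewrite -rowE.
have -> : row l' (map_mx (horner_eval a') (Mat (xvar i ^+ kk))) =
    row (enum_rank ((i, l') : T)) (map_mx (horner_eval a') G).
  by apply/rowP => j; rewrite !mxE enum_rankK.
exact: row_sub.
Qed.

(* The Cayley-Hamilton relation of f over K[s], divided by the largest possible
   power of f, puts a nonzero polynomial in s into I' + (f). *)
Lemma sat_ideal_finite_codim (S : P -> Prop) (f : P) : S 1 ->
    (forall q q', S q -> S q' -> S (q * q')) ->
  exists r (e : 'I_r -> P),
    spans_mod (@mpolyC n {poly K} \o polyC) (sat_ideal S (ideal_span at_) f 1) e.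
Proof.
move=> S1 SM; have idat := ideal_span_ideal at_.
have id1 := sat_ideal_ideal f S1 SM idat 1.
have [k [c [Q [c0 chiE]]]] := poly_factorX (monic_neq0 (char_poly_monic (Mat f))).
pose phi : {poly {poly K}} -> P := horner_eval f \o map_poly (@mpolyC n {poly K}).
have I1c : sat_ideal S (ideal_span at_) f 1 (mpolyC n c).
  exists 1, k, (phi Q); split=> //.
  have -> : f ^+ k * (1 * mpolyC n c + phi Q * f ^+ 1) = phi (char_poly (Mat f)).
    rewrite chiE /phi !(rmorphM, rmorphD)/= /horner_eval map_polyXn map_polyX.
    by rewrite map_polyC hornerXn hornerX hornerC/= mulrC mul1r addrC.
  rewrite /phi /char_poly -det_map_mx; set M := map_mx _ _.
  have ME i : \sum_j M i j * b j = f * b i - \sum_j nf (f * b i) 0 j *: b j.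
    under eq_bigr do rewrite !mxE.
    under eq_bigr => j _.
      rewrite /= rmorphB/= rmorphMn/= map_polyX map_polyC /horner_eval.
      rewrite hornerD hornerN hornerMn hornerX hornerC/= mulrBl mul_mpolyC.
      over.
    rewrite sumrB; congr (_ - _).
    rewrite (bigD1 i)//= eqxx mulr1n big1 ?addr0// => j ji.
    by rewrite eq_sym (negbTE ji) mulr0n mul0r.
  have Mb : forall j, ideal_span at_ (\det M * b j).
    by apply: ideal_det => // i; rewrite ME; exact: nf_span.
  rewrite -[\det M]mulr1.
  apply: (ideal_eq idat (h := \det M * \sum_j nf 1 0 j *: b j)).
    by rewrite -mulrBr; apply: idealMl => //; exact: nf_span.
  rewrite mulr_sumr; apply: ideal_sum => // j _.
  by rewrite -scalerAr -mul_mpolyC; apply: idealMl.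
(* Since [c] lies in the ideal, coefficients in [K[s]] reduce modulo [c], which leaves finitely many
   powers of [s]. *)
pose e (t : 'I_D * 'I_(size c)) := mpolyC n ('X ^+ t.2) * b t.1.
eexists _, _; apply: (@spans_mod_fin _ _ _ _ _ e) => g.
exists (fun t : 'I_D * 'I_(size c) => (nf g 0 t.1 %% c)`_t.2).
apply: (ideal_sub_trans id1 (h := \sum_j nf g 0 j *: b j)).
  exact/sat_ideal_sub/nf_span.
rewrite -(pair_bigA _ (fun (j : 'I_D) (l : 'I_(size c)) => (@mpolyC n {poly K} \o polyC)
  (nf g 0 j %% c)`_l * e (j, l)))/=.
rewrite -sumrB; apply: ideal_sum => // j _.
have -> : \sum_(l < size c) mpolyC n ((nf g 0 j %% c)`_l)%:P * e (j, l) =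
    (nf g 0 j %% c) *: b j.
  have cs : (size (nf g 0 j %% c)%R <= size c)%N by rewrite ltnW// ltn_modp.
  rewrite -[in RHS](coefK (nf g 0 j %% c)) poly_def.
  rewrite (big_ord_widen _ (fun l => (nf g 0 j %% c)`_l *: 'X^l) cs).
  rewrite scaler_suml [in RHS]big_mkcond; apply: eq_bigr => l _.
  rewrite /e/= mulrA -mpolyCM mul_polyC mul_mpolyC.
  by case: ltnP => // /leq_sizeP/(_ _ (leqnn _)) ->; rewrite !scale0r.
rewrite {1}(divp_eq (nf g 0 j) c) scalerDl addrK mulrC -scalerA -mul_mpolyC.
by apply: idealMr.
Qed.

End Family.

(** * Convergent power series *)

Lemma ler_sum_subset (R : numDomainType) (T : eqType) (s t : seq T) (F : T -> R) :
  uniq s -> {subset s <= t} -> (forall x, 0 <= F x) ->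
  \sum_(x <- s) F x <= \sum_(x <- t) F x.
Proof.
move=> + + F0; elim: s t => [|x s IH] t /=.
  by move=> _ _; rewrite big_nil sumr_ge0.
move=> /andP[xs us] st; have xt : x \in t by apply: st; rewrite mem_head.
rewrite big_cons (perm_big _ (perm_to_rem xt)) big_cons lerD2l.
apply: IH => // y ys.
have yx : y != x by apply: contraNneq xs => <-.
have : y \in x :: rem x t.
  by rewrite -(perm_mem (perm_to_rem xt)); apply: st; rewrite inE ys orbT.
by rewrite inE (negbTE yx).
Qed.

Section FormalSeries.
Variables (K : fieldType) (n : nat).
Implicit Types (f g h : fps K n) (m : multinom n) (p q : mpoly n K).

Lemma fpsDE f g m : (f + g) m = f m + g m. Proof. by []. Qed.
Lemma fpsBE f g m : (f - g) m = f m - g m. Proof. by []. Qed.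

Definition fps_poly p : fps K n := fun m => mcoeff m p.

Lemma fps_polyM p q : fps_poly (p * q) = fps_poly p * fps_poly q.
Proof.
apply/funext => m; rewrite -[RHS]/(fps_mul _ _ m) (fps_mulE _ _ (ltnSn (mdeg m))).
by apply: mcoeffM_eq => k km; rewrite fps_truncE.
Qed.

Lemma fps_mulX g i k m : (g * fps_poly (xvar i ^+ k)) m =
  if (k <= m i)%N then g (mnm_sub m (mnm_muln (mnm1 i) k)) else 0.
Proof.
rewrite -[LHS]/(fps_mul _ _ m) (fps_mulE _ _ (ltnSn (mdeg m))).
pose G := fps_trunc (mdeg m).+1 g.
rewrite (@mcoeffM_eq _ _ _ _ G (xvar i ^+ k))//; last first.
  by move=> l lm; rewrite fps_truncE.
rewrite mpolyXn; case: leqP => km.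
  have E : m = mnm_add (mnm_muln (mnm1 i) k) (mnm_sub m (mnm_muln (mnm1 i) k)).
    rewrite addmC submK//; apply/mnm_lepP => j; rewrite mulmnE mnm1E.
    by case: eqP => [<-|]; rewrite ?mul1n ?mul0n.
  by rewrite {1}E mcoeffMX fps_truncE// ltnS mdegB.
rewrite mcoeffM big1// => -[[a alt] [b blt]] /= /eqP E.
rewrite [X in _ * X]mcoeffX; case: eqP => [bE|]; last by rewrite mulr0.
by move: km; rewrite E mnmDE -bE mulmnE mnm1E eqxx mul1n ltnNge leq_addl.
Qed.

Lemma fps_derivD i f g : fps_deriv i (f + g) = fps_deriv i f + fps_deriv i g.
Proof. by apply/funext => m; rewrite fpsDE /fps_deriv fpsDE mulrnDl. Qed.

Lemma fps_derivM i f g :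
  fps_deriv i (f * g) = fps_deriv i f * g + f * fps_deriv i g.
Proof.
apply/funext => m; rewrite [LHS]/fps_deriv.
rewrite -[RHS]/(fps_mul (fps_deriv i f) g m + fps_mul f (fps_deriv i g) m).
rewrite -[(f * g) _]/(fps_mul f g _).
(* Differentiation lowers the degree by one, so the truncation has to keep degree [mdeg m + 1]. *)
have md : (mdeg (mnm_add m (mnm1 i)) < (mdeg m).+2)%N by rewrite mdegD mdeg1 addn1.
rewrite (fps_mulE _ _ md) -mcoeff_deriv mderivM mcoeffD.
rewrite !(fps_mulE _ _ (ltnSn (mdeg m))).
have dT h k : (mdeg k <= mdeg m)%N -> mcoeff k (mderiv i (fps_trunc (mdeg m).+2 h)) =
    mcoeff k (fps_trunc (mdeg m).+1 (fps_deriv i h)).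
  move=> km; rewrite mcoeff_deriv !fps_truncE//.
  by rewrite mdegD mdeg1 addn1.
have TT h k : (mdeg k <= mdeg m)%N -> mcoeff k (fps_trunc (mdeg m).+2 h) =
    mcoeff k (fps_trunc (mdeg m).+1 h).
  by move=> km; rewrite !fps_truncE// ltnS ltnW.
by congr (_ + _); apply: mcoeffM_eq => k km; rewrite ?dT ?TT.
Qed.

Definition ord_ge k f := forall m, (mdeg m < k)%N -> f m = 0.

Lemma ord_geD k f g : ord_ge k f -> ord_ge k g -> ord_ge k (f + g).
Proof.
by move=> fk gk m mk; rewrite -[LHS]/(f m + g m) fk ?gk ?addr0.
Qed.

Lemma ord_geM k l f g : ord_ge k f -> ord_ge l g -> ord_ge (k + l) (f * g).
Proof.
move=> fk gl m mkl; rewrite -[LHS]/(fps_mul f g m).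
apply: big1 => -[[i ilt] [j jlt]] /= /eqP E.
have [ik|ki] := ltnP (mdeg i) k; first by rewrite fk ?mul0r.
rewrite gl ?mulr0// -(ltn_add2l k); apply: leq_ltn_trans mkl.
by rewrite E mdegD leq_add2r.
Qed.

Lemma ord_ge_le k l f : (l <= k)%N -> ord_ge k f -> ord_ge l f.
Proof. by move=> lk fk m ml; apply: fk; apply: leq_trans lk. Qed.

Lemma ord_ge_deriv k i f : ord_ge k.+1 f -> ord_ge k (fps_deriv i f).
Proof.
by move=> fk m mk; rewrite /fps_deriv fk ?mul0rn// mdegD mdeg1 addn1.
Qed.

Lemma ord_ge_trunc k f : ord_ge k (f - fps_poly (fps_trunc k f)).
Proof.
move=> m mk; rewrite -[LHS]/(f m - mcoeff m (fps_trunc k f)).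
by rewrite fps_truncE ?subrr.
Qed.

(** The inverse is the geometric series: [h ^+ k] has order at least [k], so the coefficient at [m]
    of the partial sums is constant beyond [mdeg m]. *)
Lemma fps_geometric h : ord_ge 1 h -> exists g, g * (1 - h) = 1.
Proof.
move=> h1; pose S d := \sum_(k < d) h ^+ k.
have hk k : ord_ge k (h ^+ k).
  elim: k => [|k IH]; first by [].
  by rewrite exprS -addn1 addnC; apply: ord_geM.
have SS d e m : (mdeg m < d)%N -> (d <= e)%N -> S e m = S d m.
  move=> md de; rewrite -(subnK de) addnC /S big_split_ord/=.
  rewrite -[LHS]/((\sum_(k < d) h ^+ k) m + (\sum_(k < e - d) h ^+ (d + k)) m).
  rewrite [X in _ + X](_ : _ = 0) ?addr0//.
  have : ord_ge d (\sum_(k < e - d) h ^+ (d + k)).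
    elim/big_ind: _ => [//|f g|k _]; first exact: ord_geD.
    by apply: ord_ge_le (hk _); exact: leq_addr.
  exact.
pose g : fps K n := fun m => S (mdeg m).+1 m.
exists g; apply/funext => m; pose d := (mdeg m).+1.
have gS : ord_ge d (g - S d).
  by move=> k kd; rewrite fpsBE [S d k](SS (mdeg k).+1) ?subrr.
have -> : g * (1 - h) = 1 - h ^+ d + (g - S d) * (1 - h).
  have := subrX1 h d; rewrite -/(S d) => hd.
  have -> : 1 - h ^+ d = S d * (1 - h) by rewrite -opprB hd; ring.
  by ring.
rewrite fpsDE fpsBE (hk d) ?ltnSn// subr0 -[RHS]addr0; congr (_ + _).
have := ord_geM (l := 0) (g := 1 - h) gS; rewrite addn0; exact.
Qed.

End FormalSeries.

Section ConvergentSeries.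
Variables (R : realType) (K : fieldType) (v : absval R K) (n : nat).
Implicit Types (f g h : fps K n) (m : multinom n) (p q : mpoly n K).

Lemma convergent_poly p : fps_poly p \in convergent v n.
Proof.
apply/convergentP; exists (fun=> 1), (\sum_(m <- msupp p) v (mcoeff m p)).
split=> // s us.
have E m : v (fps_poly p m) * mon (fun=> 1) m = v (mcoeff m p) :> R.
  by rewrite /mon big1 ?mulr1// => i _; rewrite expr1n.
rewrite (eq_bigr _ (fun m _ => E m)) (bigID (mem (msupp p)))/=.
rewrite [X in _ + X]big1 ?addr0 => [|m /memN_msupp_eq0 ->]; last exact: absval0.
rewrite -big_filter; apply: ler_sum_subset => [||m]; last exact: absval_ge0.
  exact: filter_uniq.
by move=> m; rewrite mem_filter => /andP[].
Qed.

(** Cutting at degree [d] keeps the norm finite before convergence is known, so that inequalities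
    involving it on both sides can be solved. *)
Definition norm_upto (e : 'I_n -> R) d f : R :=
  \sum_(m : bmultinom n d) v (f m) * mon e m.

Lemma norm_upto_ge0 e d f : (forall i, 0 < e i) -> 0 <= norm_upto e d f.
Proof.
by move=> e0; apply: sumr_ge0 => m _; rewrite mulr_ge0 ?absval_ge0 ?ltW ?mon_gt0.
Qed.

Lemma norm_uptoM e d f g : (forall i, 0 < e i) ->
  norm_upto e d (f * g) <= norm_upto e d f * norm_upto e d g.
Proof.
move=> e0; pose w f m := v (f m) * mon e m.
have w0 f' m : 0 <= w f' m by rewrite mulr_ge0 ?absval_ge0 ?ltW ?mon_gt0.
pose F (k : bmultinom n d * bmultinom n d) := w f k.1 * w g k.2.
apply: (@le_trans _ _ (\sum_(m : bmultinom n d)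
    \sum_(k : bmultinom n d * bmultinom n d | m == mnm_add k.1 k.2 :> multinom n)
      F k)).
  apply: ler_sum => m _; rewrite (fps_mul_bnd f g (bmdeg m)).
  apply: (@le_trans _ _ ((\sum_(k : bmultinom n d * bmultinom n d
      | m == mnm_add k.1 k.2 :> multinom n) v (f k.1 * g k.2)) * mon e m)).
    by rewrite ler_wpM2r ?absval_sum// ltW ?mon_gt0.
  rewrite mulr_suml; apply: ler_sum => k /eqP ->.
  by rewrite absvalM monD /F mulrACA.
rewrite /norm_upto mulr_suml; under [leRHS]eq_bigr do rewrite mulr_sumr.
rewrite pair_big/= (exchange_big_dep xpredT)//=.
apply: ler_sum => k _; rewrite sumr_const -[leRHS]mulr1n ler_wpMn2l//.
  by rewrite mulr_ge0.
rewrite (@leq_trans #|[pred m : bmultinom n d | val m == mnm_add k.1 k.2]|)//.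
case: (pickP [pred m : bmultinom n d | val m == mnm_add k.1 k.2]) => [m0 /eqP m0E|m0].
  rewrite (@eq_card1 _ m0)// => m; rewrite !inE; apply/eqP/eqP => [mE|->//].
  by apply: val_inj; rewrite mE.
by rewrite eq_card0.
Qed.

Lemma convergent_norm_upto e f M : (forall i, 0 < e i) ->
  (forall d, norm_upto e d f <= M) -> f \in convergent v n.
Proof.
move=> e0 fM; apply/convergentP; exists e, M; split=> // s us.
pose d := (\max_(m <- s) mdeg m).+1; apply: le_trans (fM d).
rewrite /norm_upto -(big_map (@bmnm n d) xpredT (fun m => v (f m) * mon e m)).
apply: ler_sum_subset => // [m ms|m]; last first.
  by rewrite mulr_ge0 ?absval_ge0 ?ltW ?mon_gt0.
have md : (mdeg m < d)%N by rewrite ltnS; apply: leq_bigmax_seq.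
by apply/mapP; exists (BMultinom md) => //; rewrite mem_index_enum.
Qed.

Lemma norm_upto_convergent f : f \in convergent v n ->
  exists e M, (forall i, 0 < e i) /\ forall d, norm_upto e d f <= M.
Proof.
move=> /convergentP[e [M [e0 fM]]]; exists e, M; split=> // d.
rewrite /norm_upto -(big_map (@bmnm n d) xpredT (fun m => v (f m) * mon e m)).
by apply: fM; rewrite map_inj_uniq ?index_enum_uniq//; exact: val_inj.
Qed.

(** On radii where [h] has norm at most 1/2, the equation [g = 1 + h * g] bounds the norm of [g] by
    one plus half of itself, hence by 2. *)
Lemma convergent_geometric g h : ord_ge 1 h -> h \in convergent v n ->
  g * (1 - h) = 1 -> g \in convergent v n.
Proof.
move=> h1 /norm_upto_convergent[e [M [e0 hM]]] gh.
have M0 : 0 <= M by apply: le_trans (hM 0%N); exact: norm_upto_ge0.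
(* As [h] has no constant term, scaling the radii by [l <= 1] multiplies its norm by at most [l],
   and [l * M <= 1/2]. *)
pose l := (2 * (M + 1))^-1.
have l0 : 0 < l by rewrite invr_gt0 mulr_gt0// ltr_wpDl.
have l1 : l <= 1 by rewrite invf_le1 ?mulr_gt0 ?ltr_wpDl//; lra.
pose e' i := l * e i.
have e'0 i : 0 < e' i by rewrite mulr_gt0.
have h2 d : norm_upto e' d h <= 2^-1.
  apply: (@le_trans _ _ (l * M)); last first.
    rewrite /l invfM -mulrA ler_piMr ?invr_ge0// mulrC ler_pdivrMr ?mul1r; lra.
  apply: le_trans (ler_wpM2l (ltW l0) (hM d)); rewrite mulr_sumr.
  apply: ler_sum => m _; have [m1|m1] := ltnP (mdeg m) 1.
    by rewrite h1// absval0 !mul0r mulr0.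
  rewrite [leRHS]mulrCA ler_wpM2l ?absval_ge0//.
  have -> : mon e' m = l ^+ mdeg m * mon e m.
    rewrite /mon mdegE expr_sum -big_split; apply: eq_bigr => i _.
    by rewrite exprMn.
  rewrite ler_wpM2r ?(ltW (mon_gt0 _ _))//.
  by rewrite -(prednK m1) exprS ler_piMr ?exprn_ile1 ?(ltW l0).
apply: (@convergent_norm_upto e' _ 2) => // d.
have gE : g = 1 + h * g by rewrite mulrBr mulr1 in gh; rewrite -gh; ring.
have : norm_upto e' d g <= 1 + norm_upto e' d h * norm_upto e' d g.
  apply: (@le_trans _ _ (norm_upto e' d 1 + norm_upto e' d (h * g))).
    rewrite /norm_upto {1}gE -big_split; apply: ler_sum => m _ /=.
    by rewrite -mulrDl ler_wpM2r ?absvalD// ltW ?mon_gt0.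
  apply: lerD; last exact: norm_uptoM.
  case: d => [|d]; first by rewrite /norm_upto big1// => -[m].
  have d0 : (mdeg (@mnm0 n) < d.+1)%N by rewrite mdeg0.
  rewrite /norm_upto (bigD1 (BMultinom d0))//= big1 ?addr0 => [|m].
    rewrite /mon big1 ?mulr1 => [|i _]; last by rewrite mnm0E expr0.
    by rewrite -[(1 : fps K n) _]/((mnm0 == mnm0)%:R) eqxx absval1.
  rewrite -val_eqE/= => m0.
  by rewrite -[(1 : fps K n) _]/((_ == mnm0)%:R) (negbTE m0) absval0 mul0r.
have := ler_wpM2r (norm_upto_ge0 d g e'0) (h2 d).
set x := norm_upto _ _ g; set y := _ * _ => *; lra.
Qed.

End ConvergentSeries.

Section ConvergentRing.
Variables (R : realType) (K : fieldType) (v : absval R K) (n : nat).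
Local Notation A := (cps v n).
Implicit Types (f g h : A) (m : multinom n) (p q : mpoly n K).

Lemma cpsP f g : cps_val f =1 cps_val g -> f = g.
Proof. by move=> fg; apply: val_inj; apply/funext. Qed.

Lemma cps_valM f g : cps_val (f * g) = cps_val f * cps_val g.
Proof. exact: (rmorphM (\val : A -> fps K n)). Qed.

Lemma cps_sumE (I : Type) (r : seq I) (P : pred I) (F : I -> A) m :
  cps_val (\sum_(i <- r | P i) F i) m = \sum_(i <- r | P i) cps_val (F i) m.
Proof. by elim/big_rec2: _ => // i y z _ <-. Qed.

Definition cps_poly p : A := Cps (convergent_poly v p).

Fact cps_poly_zmod_morphism : zmod_morphism cps_poly.
Proof. by move=> p q; apply: cpsP => m; rewrite /= /fps_poly mcoeffB. Qed.

Fact cps_poly_monoid_morphism : monoid_morphism cps_poly.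
Proof.
split; first by apply: cpsP => m; rewrite /= /fps_poly mcoeff1.
by move=> p q; apply: val_inj; rewrite /= fps_polyM.
Qed.

HB.instance Definition _ :=
  GRing.isZmodMorphism.Build _ _ cps_poly cps_poly_zmod_morphism.
HB.instance Definition _ :=
  GRing.isMonoidMorphism.Build _ _ cps_poly cps_poly_monoid_morphism.

Lemma cps_polyZ c p : cps_poly (c *: p) = c *: cps_poly p.
Proof. by apply: cpsP => m; rewrite /= /fps_poly mcoeffZ. Qed.

Definition cps_var i : A := cps_poly (xvar i).

Lemma mmap_cps_poly p : mmap (in_alg A) cps_var p = cps_poly p.
Proof.
elim/mpolyind: p => [|c m p _ _ IH]; first by rewrite !rmorph0.
rewrite !rmorphD/= IH mmapZ cps_polyZ mmapX; congr (_ + _).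
rewrite mulr_algl mpolyXE_id rmorph_prod; congr (_ *: _).
by apply: eq_bigr => i _; rewrite rmorphXn.
Qed.

Lemma cps_trunc k f : exists r : A,
  f = cps_poly (fps_trunc k f) + r /\ ord_ge k r.
Proof.
exists (f - cps_poly (fps_trunc k f)).
by split; [rewrite addrC subrK|exact: ord_ge_trunc].
Qed.

Lemma cps_mulXn g i k m : cps_val (g * cps_var i ^+ k) m =
  if (k <= m i)%N then cps_val g (mnm_sub m (mnm_muln (mnm1 i) k)) else 0.
Proof. by rewrite /cps_var -rmorphXn cps_valM fps_mulX. Qed.

(** A monomial of degree above [n * k] has an exponent at least [k], and [jj] picks one such
    variable. So [z j] is a shifted part of [g] and converges on the same radii. *)
Lemma ord_ge_ideal_span k g : ord_ge (n * k).+1 g ->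
  ideal_span (fun j => cps_var j ^+ k) g.
Proof.
move=> gk; pose jj (m : multinom n) := [pick j | (k <= m j)%N].
pose ek j : multinom n := mnm_muln (mnm1 j) k.
pose z j : fps K n := fun m =>
  if jj (mnm_add m (ek j)) == Some j then cps_val g (mnm_add m (ek j)) else 0.
have zc j : z j \in convergent v n.
  have /convergentP[e [M [e0 gM]]] := cps_valP g.
  apply/convergentP; exists e, (M / mon e (ek j)); split=> // s us.
  rewrite ler_pdivlMr ?mon_gt0// mulr_suml.
  have us' : uniq [seq mnm_add m (ek j) | m <- s].
    by rewrite map_inj_uniq// => m1 m2 /addIm.
  apply: le_trans (gM _ us'); rewrite big_map; apply: ler_sum => m _.
  rewrite monD mulrA !ler_wpM2r ?(ltW (mon_gt0 _ _))// /z.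
  by case: eqP => // _; rewrite absval0 absval_ge0.
exists (fun j => Cps (zc j)); apply: cpsP => m; rewrite cps_sumE.
under eq_bigr => j _.
  rewrite cps_mulXn/= /z -/(ek j).
  rewrite (_ : (if _ then _ else _) = if jj m == Some j then cps_val g m else 0).
    over.
  case: ifPn => kj.
    rewrite submK//; apply/mnm_lepP => l; rewrite mulmnE mnm1E.
    by case: eqP => [<-|]; rewrite ?mul1n ?mul0n.
  case: eqP => // E; move: E kj; rewrite /jj; case: pickP => // l kl [<-].
  by rewrite kl.
rewrite /jj; case: pickP => [j kj|mk].
  rewrite (bigD1 j)//= eqxx big1 ?addr0// => l lj.
  by case: eqP => // -[jl]; rewrite jl eqxx in lj.
rewrite big1 ?gk// ltnS mdegE mulnC -[X in (_ <= _ * X)%N](card_ord n).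
rewrite mulnC -sum_nat_const; apply: leq_sum => j _.
by rewrite ltnW// ltnNge; have /= -> := mk j.
Qed.

Lemma cps_coef0M f g : cps_val (f * g) mnm0 = cps_val f mnm0 * cps_val g mnm0.
Proof.
rewrite cps_valM -[LHS]/(fps_mul _ _ mnm0).
rewrite (fps_mulE _ _ (d := 1)) ?mdeg0// rmorphM/=.
by rewrite !fps_truncE ?mdeg0.
Qed.

Definition cps_coef0 f : K := cps_val f mnm0.

Lemma cps_coef01 : cps_val (1 : A) mnm0 = 1.
Proof. by rewrite -[LHS]/((mnm0 == mnm0)%:R) eqxx. Qed.

Fact cps_coef0_zmod_morphism : zmod_morphism cps_coef0.
Proof. by []. Qed.

Fact cps_coef0_monoid_morphism : monoid_morphism cps_coef0.
Proof. by split; [exact: cps_coef01|exact: cps_coef0M]. Qed.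

HB.instance Definition _ :=
  GRing.isZmodMorphism.Build _ _ cps_coef0 cps_coef0_zmod_morphism.
HB.instance Definition _ :=
  GRing.isMonoidMorphism.Build _ _ cps_coef0 cps_coef0_monoid_morphism.

Lemma cps_coef0X i : cps_coef0 (cps_var i) = 0.
Proof. by rewrite /cps_coef0 /= /fps_poly mcoeffX mnm1_eq0. Qed.

(** Divided by its constant coefficient, [f] is [1 - h] with [h] of positive order, and the
    geometric series converges. *)
Lemma cps_unitE f : (f \is a GRing.unit) = (cps_val f mnm0 != 0).
Proof.
apply/idP/idP => [fU|f0].
  have := congr1 (fun g : A => cps_val g mnm0) (divrr fU); rewrite cps_coef0M => ff.
  apply/eqP => f0; move/eqP: ff; rewrite f0 mul0r eq_sym.
  by rewrite -[cps_val (1 : A) mnm0]/((mnm0 == mnm0)%:R) eqxx oner_eq0.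
pose h := 1 - (cps_val f mnm0)^-1 *: f.
have h1 : ord_ge 1 h.
  move=> m; rewrite ltnS leqn0 mdeg_eq0 => /eqP ->.
  rewrite -[LHS]/((mnm0 == mnm0)%:R - (cps_val f mnm0)^-1 * cps_val f mnm0).
  by rewrite eqxx mulVf ?subrr.
have [g gh] := fps_geometric h1.
pose G := Cps (convergent_geometric h1 (cps_valP h) gh).
have Gh : G * (1 - h) = 1 by apply: val_inj.
apply/unitrPr; exists ((cps_val f mnm0)^-1 *: G).
by rewrite -[RHS]Gh /h subKr -scalerAr scalerAl mulrC.
Qed.

Lemma cps_derivE i f m :
  cps_val (cps_deriv i f) m = cps_val f (mnm_add m (mnm1 i)) *+ (m i).+1.
Proof. by []. Qed.

Lemma cps_derivD i f g : cps_deriv i (f + g) = cps_deriv i f + cps_deriv i g.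
Proof. by apply: val_inj; exact: fps_derivD. Qed.

Lemma cps_derivM i f g :
  cps_deriv i (f * g) = cps_deriv i f * g + f * cps_deriv i g.
Proof.
apply: val_inj; rewrite /= fps_derivM.
by rewrite -[RHS]/(val (cps_deriv i f) * val g + val f * val (cps_deriv i g)).
Qed.

Lemma cps_deriv_poly i p : cps_deriv i (cps_poly p) = cps_poly (mderiv i p).
Proof. by apply: cpsP => m; rewrite /= /fps_poly mcoeff_deriv. Qed.

Lemma ord_ge0_eq0 f : (forall k, ord_ge k f) -> f = 0.
Proof. by move=> f0; apply: cpsP => m; apply: (f0 (mdeg m).+1). Qed.

Lemma cps_ord_ge1 f : cps_val f mnm0 = 0 -> ord_ge 1 f.
Proof.
by move=> f0 m; rewrite ltnS leqn0 mdeg_eq0 => /eqP ->.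
Qed.

Lemma cps_ord_geM k l f g : ord_ge k f -> ord_ge l g -> ord_ge (k + l) (f * g).
Proof. by rewrite cps_valM; exact: ord_geM. Qed.

Lemma cps_ord_geXn k f : ord_ge 1 f -> ord_ge k (f ^+ k).
Proof.
move=> f1; elim: k => [//|k IH]; rewrite exprS -addn1 addnC.
exact: cps_ord_geM.
Qed.

Lemma cps_ord_ge_sum k (I : Type) (r : seq I) (P : pred I) (F : I -> A) :
  (forall i, P i -> ord_ge k (F i)) -> ord_ge k (\sum_(i <- r | P i) F i).
Proof.
by move=> Fk; elim/big_ind: _ => // f g; exact: ord_geD.
Qed.

End ConvergentRing.

(** * Milnor numbers and automorphisms *)

Section MilnorBasis.
Variables (R : realType) (K : fieldType) (v : absval R K) (n : nat).
Local Notation A := (cps v n).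
Implicit Types (f g h : A).

Definition jacobian_ideal f : A -> Prop := ideal_span (fun i => cps_deriv i f).

Lemma jacobian_ideal_ideal f : is_ideal (jacobian_ideal f).
Proof. exact: ideal_span_ideal. Qed.

(** Finite Milnor numbers expressed by representatives in [A], without the quotient;
    [milnor_numberP] is the link. *)
Definition milnor_basis f d : Prop := exists b : 'I_d -> A,
  spans_mod (in_alg A) (jacobian_ideal f) b /\
  free_mod (in_alg A) (jacobian_ideal f) b.

Let W f : zmodClosed A := ideal_gen (fun i => cps_deriv i f).

Let pi f (g : A) : milnor_algebra f := (\pi_(Quotient.quot (W f)) g)%qT.

Let piP f g h : pi f g = pi f h <-> jacobian_ideal f (g - h).
Proof.
rewrite /jacobian_ideal /ideal_span; split=> [/eqP|J].
  rewrite -[_ == _]/(\pi_(Quotient.quot (W f)) g == \pi_(Quotient.quot (W f)) h)%qT.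
  by rewrite -Quotient.idealrBE => /asboolP.
apply/eqP.
rewrite -[_ == _]/(\pi_(Quotient.quot (W f)) g == \pi_(Quotient.quot (W f)) h)%qT.
by rewrite -Quotient.idealrBE; apply/asboolP.
Qed.

Let pi_comb f d (c : 'I_d -> K) (b : 'I_d -> A) :
  \sum_i c i *: pi f (b i) = pi f (\sum_i in_alg A (c i) * b i).
Proof.
rewrite [RHS](raddf_sum (\pi_(Quotient.quot (W f)))%qT).
apply: eq_bigr => i _; rewrite mulr_algl.
exact: (pi_quot_scale (ideal_gen_scaler_closed (s := fun i => cps_deriv i f))).
Qed.

Let pi_surj f (x : milnor_algebra f) : exists g, x = pi f g.
Proof. by elim/quot_lmodW: x => u; exists u. Qed.

Let pi0 f : pi f 0 = 0.
Proof. exact: (raddf0 (\pi_(Quotient.quot (W f)))%qT). Qed.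

Lemma milnor_numberP f d : milnor_number f = Some d <-> milnor_basis f d.
Proof.
split=> [|[b [sb fb]]].
  rewrite /milnor_number /dimension; case: pselect => // ex [<-].
  case: cid => e /= [b [fb sb]].
  have [B BE] := choice (fun i => pi_surj (b i)).
  have bE : b = pi f \o B by apply/funext.
  exists B; split=> [g|c /= Jc].
    have [c cE] := sb (pi f g); exists c; apply/piP.
    by rewrite cE bE pi_comb.
  by apply: fb; rewrite bE pi_comb -(pi0 f); apply/piP; rewrite subr0.
apply: (@dimensionP _ _ _ (pi f \o b)); split=> [c|x].
  rewrite pi_comb -(pi0 f) => /piP; rewrite subr0; exact: fb.
have [g ->] := pi_surj x; have [c cE] := sb g.
by exists c; rewrite pi_comb; apply/piP.
Qed.

Lemma milnor_number_eq f g :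
  (forall d, milnor_basis f d <-> milnor_basis g d) ->
  milnor_number f = milnor_number g.
Proof.
move=> fg; case fE: (milnor_number f) => [d|].
  by apply/esym/milnor_numberP/fg/milnor_numberP.
case gE: (milnor_number g) => [d|] //.
by move/milnor_numberP/fg/milnor_numberP: gE; rewrite fE.
Qed.

Lemma milnor_basis_leq f d e : milnor_basis f d -> milnor_basis f e -> (d <= e)%N.
Proof.
by move=> /milnor_numberP fd /milnor_numberP; rewrite fd => -[->].
Qed.

End MilnorBasis.

(** * The chain rule and invariance under automorphisms *)

Section Automorphism.
Variables (R : realType) (K : fieldType) (v : absval R K) (n : nat).
Local Notation A := (cps v n).
Implicit Types (g h : A).

Section LocalEndomorphism.
Variable phi : {lrmorphism A -> A}.

(* An element of the maximal ideal is one that stays a nonunit after addition of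
   the opposite of any nonzero constant. *)
Lemma lrmorphism_coef0 g : cps_val g mnm0 = 0 -> cps_val (phi g) mnm0 = 0.
Proof.
move=> g0; apply/eqP/negPn/negP => c0; set c := cps_val (phi g) mnm0 in c0.
have one0 : cps_val (1 : A) mnm0 = 1.
  by rewrite -[LHS]/((mnm0 == mnm0)%:R) eqxx.
have U : g - c *: 1 \is a GRing.unit.
  rewrite cps_unitE -[cps_val _ _]/(cps_val g mnm0 - c * cps_val (1 : A) mnm0).
  by rewrite g0 one0 mulr1 sub0r oppr_eq0.
have := rmorph_unit phi U; rewrite rmorphB/= linearZ/= rmorph1 cps_unitE.
rewrite -[cps_val _ _]/(cps_val (phi g) mnm0 - c * cps_val (1 : A) mnm0).
by rewrite one0 mulr1 subrr eqxx.
Qed.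

Let y j := phi (cps_var v j).

Let ord_y j : ord_ge 1 (y j).
Proof.
apply/cps_ord_ge1/lrmorphism_coef0; rewrite /= /fps_poly mcoeffX.
by rewrite mnm1_eq0.
Qed.

(** The defect [E] is a derivation along [phi] that vanishes on the variables, hence on polynomials.
    A remainder of high order is a combination of the [x_j^k], and [E] of it has order at least [k];
    as [k] is arbitrary, [E] is zero. *)
Lemma chain_rule i g :
  cps_deriv i (phi g) = \sum_j phi (cps_deriv j g) * cps_deriv i (y j).
Proof.
pose E g := cps_deriv i (phi g) - \sum_j phi (cps_deriv j g) * cps_deriv i (y j).
have ED g1 g2 : E (g1 + g2) = E g1 + E g2.
  rewrite /E rmorphD cps_derivD; under eq_bigr do rewrite cps_derivD rmorphD mulrDl.
  by rewrite big_split/=; ring.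
have EM g1 g2 : E (g1 * g2) = E g1 * phi g2 + phi g1 * E g2.
  rewrite /E rmorphM cps_derivM.
  have -> : \sum_j phi (cps_deriv j (g1 * g2)) * cps_deriv i (y j) =
      (\sum_j phi (cps_deriv j g1) * cps_deriv i (y j)) * phi g2 +
      phi g1 * \sum_j phi (cps_deriv j g2) * cps_deriv i (y j).
    rewrite mulr_suml mulr_sumr -big_split; apply: eq_bigr => j _ /=.
    by rewrite cps_derivM rmorphD !rmorphM; ring.
  ring.
have E1 : E 1 = 0.
  have := EM 1 1; rewrite mulr1 rmorph1 mulr1 mul1r => /eqP.
  by rewrite -subr_eq0 opprD addNKr oppr_eq0 => /eqP.
have EZ c g1 : E (c *: g1) = c *: E g1.
  have dZ l h : cps_deriv l (c *: h) = c *: cps_deriv l h.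
    apply: cpsP => m; rewrite cps_derivE.
    by rewrite -[RHS]/(c * (cps_val h (mnm_add m (mnm1 l)) *+ (m l).+1)) mulrnAr.
  rewrite /E linearZ/= dZ scalerBr scaler_sumr; congr (_ - _).
  by apply: eq_bigr => j _; rewrite dZ linearZ/= scalerAl.
have EX l : E (cps_var v l) = 0.
  rewrite /E (bigD1 l)//= big1 ?addr0 => [|j jl].
    rewrite /cps_var cps_deriv_poly mderivX mnm1E eqxx scale1r.
    have -> : mnm_sub (mnm1 l) (mnm1 l) = mnm0 :> multinom n.
      by apply/mnmP => j; rewrite mnmBE mnm0E subnn.
    by rewrite mpolyX0 !rmorph1 mul1r subrr.
  rewrite /cps_var cps_deriv_poly mderivX mnm1E eq_sym (negbTE jl).
  by rewrite scale0r !rmorph0 mul0r.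
have EXn l k : E (cps_var v l ^+ k) = 0.
  elim: k => [|k IH]; first by rewrite expr0.
  by rewrite exprS EM EX IH mul0r mulr0 addr0.
have E0 : E 0 = 0 by have := EZ 0 0; rewrite !scale0r.
have Epoly p : E (cps_poly v p) = 0.
  elim/mpolyind: p => [|c m p _ _ IH]; first by rewrite rmorph0.
  rewrite rmorphD ED IH addr0 /= cps_polyZ EZ mpolyXE_id rmorph_prod.
  suff -> : E (\prod_j cps_poly v (xvar j ^+ m j)) = 0 by rewrite scaler0.
  elim/big_rec: _ => // j z _ Ez; rewrite EM Ez mulr0 addr0 rmorphXn.
  by rewrite -/(cps_var v j) EXn mul0r.
apply/eqP; rewrite -subr_eq0 -/(E g); apply/eqP; apply: ord_ge0_eq0 => k.
have [r [-> /ord_ge_ideal_span[z ->]]] := cps_trunc (n * k).+1 g.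
rewrite ED Epoly add0r.
have -> : E (\sum_j z j * cps_var v j ^+ k) = \sum_j E (z j) * y j ^+ k.
  elim/big_rec2: _ => [//|j a b _ <-]; rewrite ED EM EXn mulr0 addr0.
  by rewrite rmorphXn.
apply: cps_ord_ge_sum => j _; rewrite -[k]add0n; apply: cps_ord_geM => //.
exact: cps_ord_geXn.
Qed.

End LocalEndomorphism.

(** By the chain rule the partial derivatives of [phi g] are combinations of the images of those of
    [g]; the inverse of [phi] pulls such a combination back. *)
Lemma jacobian_ideal_reflect (phi : {lrmorphism A -> A}) g h : bijective phi ->
  jacobian_ideal (phi g) (phi h) -> jacobian_ideal g h.
Proof.
move=> [psi phiK psiK] [a /(congr1 psi)]; rewrite phiK => ->.
exists (fun j => psi (\sum_i a i * cps_deriv i (phi (cps_var v j)))).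
apply: (can_inj phiK); rewrite psiK rmorph_sum.
under [RHS]eq_bigr do rewrite rmorphM/= psiK mulr_suml.
rewrite exchange_big; apply: eq_bigr => i _ /=.
rewrite chain_rule mulr_sumr; apply: eq_bigr => j _.
by rewrite mulrAC mulrA.
Qed.

Lemma lrmorphism_inverse (phi : {lrmorphism A -> A}) : bijective phi ->
  exists2 psi : {lrmorphism A -> A}, cancel phi psi & cancel psi phi.
Proof.
move=> [psi phiK psiK].
have psiB : zmod_morphism psi := can2_zmod_morphism phiK psiK.
have psiM : monoid_morphism psi := can2_monoid_morphism phiK psiK.
have psiZ : scalable psi := can2_scalable phiK psiK.
pose m1 := GRing.isZmodMorphism.Build A A psi psiB.
pose m2 := GRing.isMonoidMorphism.Build A A psi psiM.
pose m3 := GRing.isScalable.Build K A A *:%R psi psiZ.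
pose Psi : {lrmorphism A -> A} := HB.pack psi m1 m2 m3.
by exists Psi.
Qed.

Lemma jacobian_ideal_lrmorphism (phi : {lrmorphism A -> A}) g h : bijective phi ->
  jacobian_ideal (phi g) (phi h) <-> jacobian_ideal g h.
Proof.
move=> bphi; split; first exact: jacobian_ideal_reflect.
have [psi phiK psiK] := lrmorphism_inverse bphi.
move=> Jh; apply: (@jacobian_ideal_reflect psi); first by exists phi.
by rewrite !phiK.
Qed.

Lemma milnor_basis_lrmorphism (phi : {lrmorphism A -> A}) g d : bijective phi ->
  milnor_basis g d -> milnor_basis (phi g) d.
Proof.
move=> bphi [b [sb fb]]; have [psi phiK psiK] := lrmorphism_inverse bphi.
have comb (c : 'I_d -> K) :
    \sum_i in_alg A (c i) * phi (b i) = phi (\sum_i in_alg A (c i) * b i).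
  rewrite rmorph_sum; apply: eq_bigr => i _.
  by rewrite /= !mulr_algl linearZ.
exists (phi \o b); split=> [h|c /=]; last first.
  by rewrite comb => /(jacobian_ideal_lrmorphism _ _ bphi)/fb.
have [c Jc] := sb (psi h); exists c; rewrite comb -[X in X - _]psiK -rmorphB.
exact/(jacobian_ideal_lrmorphism _ _ bphi).
Qed.

Lemma milnor_number_lrmorphism (phi : {lrmorphism A -> A}) g : bijective phi ->
  milnor_number (phi g) = milnor_number g.
Proof.
move=> bphi; apply: milnor_number_eq => d; split; last exact: milnor_basis_lrmorphism.
have [psi phiK psiK] := lrmorphism_inverse bphi.
rewrite -[in milnor_basis g]( phiK g); apply: milnor_basis_lrmorphism.
by exists phi.
Qed.

End Automorphism.

(** * Multiplication by a unit *)

Section FiniteCodimension.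
Variables (R : realType) (K : fieldType) (v : absval R K) (n : nat).
Local Notation A := (cps v n).
Local Notation x_ := (cps_var v (n := n)).
Implicit Types (f g h : A).

Lemma ord_ge_mem (I : A -> Prop) k g : is_ideal I -> (forall j, I (x_ j ^+ k)) ->
  ord_ge (n * k).+1 g -> I g.
Proof. by move=> idI Ix /ord_ge_ideal_span; apply: ideal_span_sub. Qed.

(** Some [x_j^k * (y * x_j + c)] with [c] nonzero lies in [I], and its second factor is a unit. *)
Lemma var_exp_of_finite_codim (I : A -> Prop) r (e : 'I_r -> A) :
  is_ideal I -> spans_mod (in_alg A) I e -> exists k, forall j, I (x_ j ^+ k).
Proof.
move=> idI se.
have /choice[k kP] : forall j, exists k, I (x_ j ^+ k).
  move=> j.
  have [k [c [y [c0 Iy]]]] := exists_power_unit_mod (x_ j) idI se.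
  exists k; set u := _ + _ in Iy; have uU : u \is a GRing.unit.
    rewrite cps_unitE /u.
    rewrite -[cps_val _ _]/(cps_val (y * x_ j) mnm0 + c * (mnm0 == mnm0)%:R).
    rewrite cps_coef0M /= /fps_poly mcoeffX mnm1_eq0 mulr0 add0r.
    by rewrite eqxx mulr1.
  by rewrite -(mulrK uU (_ ^+ _)); apply: idealMr.
exists (\sum_j k j)%N => j; rewrite (bigD1 j)//= exprD.
exact: idealMr.
Qed.

Lemma finite_codim_of_var_exp (I : A -> Prop) k :
  is_ideal I -> (forall j, I (x_ j ^+ k)) ->
  exists r (e : 'I_r -> A), spans_mod (in_alg A) I e.
Proof.
move=> idI Ix; pose e (m : bmultinom n (n * k).+1) := cps_poly v (mpolyX K m).
eexists _, _; apply: (@spans_mod_fin _ _ _ _ _ e) => g.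
have [r [gE /(ord_ge_mem idI Ix) Ir]] := cps_trunc (n * k).+1 g.
exists (fun m : bmultinom n _ => cps_val g m); rewrite {1}gE addrAC.
apply: idealD => //; apply: eq_ind (ideal0 idI) _ _; apply/esym/eqP.
rewrite subr_eq0 rmorph_sum; apply/eqP/eq_bigr => m _ /=.
by rewrite cps_polyZ mulr_algl.
Qed.

Hypothesis K0 : [pchar K] =i pred0.

(** Modulo [I + (f)] the [f_i] vanish, hence so do the [x_j^k], and the codimension is finite. The
    saturation lemma with [S] reduced to [1] puts [f^M * (1 + b * f)] into [I]; the second factor is
    a unit, so [f] is nilpotent modulo [I]. *)
Lemma deformed_jacobian_var_exp f (w : 'I_n -> A) k : cps_val f mnm0 = 0 ->
  (forall j, jacobian_ideal f (x_ j ^+ k)) ->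
  exists l, forall j, ideal_span (fun i => cps_deriv i f + w i * f) (x_ j ^+ l).
Proof.
move=> f0 Jx; set I := ideal_span _.
have idI : is_ideal I := ideal_span_ideal _.
have If := ideal_add_ideal f idI.
have Idf i : ideal_add I f (cps_deriv i f).
  exists (- w i); rewrite mulNr opprK.
  exact: (ideal_span_gen (fun i => cps_deriv i f + w i * f)).
have Ix j : ideal_add I f (x_ j ^+ k) by apply: ideal_span_sub (Jx j).
pose S (q : A) := q = 1.
have SM q q' : S q -> S q' -> S (q * q') by rewrite /S => -> ->; rewrite mulr1.
have id1 := sat_ideal_ideal f erefl SM idI 1.
have id2 := sat_ideal_ideal f erefl SM idI 2.
have I1x j : sat_ideal S I f 1 (x_ j ^+ k) by apply: ideal_add_sat.
have I2x j : sat_ideal S I f 2 (x_ j ^+ (k + k)).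
  by rewrite exprD; apply: sat_ideal_mul1.
have [r [e se]] := finite_codim_of_var_exp id1 I1x.
(* The order is high enough for the remainder [g] to lie in the second saturated ideal and its
   derivatives in the first. *)
have [g [fE og]] := cps_trunc (n * (k + k)).+2 f.
set p := fps_trunc _ _ in fE.
have [q [M [b [-> IM]]]] : exists q M b, S q /\ I (f ^+ M * (q + b * f)).
  apply: (saturation_unit erefl SM idI se (x := x_) (p := p) K0).
    rewrite mmap_cps_poly (_ : f - _ = g); last by rewrite {1}fE addrC addKr.
    by apply: (ord_ge_mem id2 I2x); apply: ord_ge_le og.
  move=> i; rewrite mmap_cps_poly -cps_deriv_poly.
  have -> : cps_poly v p = f - g by rewrite [in RHS]fE addrK.
  have -> : cps_deriv i (f - g) = cps_deriv i f - cps_deriv i g.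
    have := cps_derivD i (f - g) g; rewrite subrK => ->; ring.
  apply: idealB => //; first exact: ideal_add_sat.
  apply: (ord_ge_mem id1 I1x); apply: ord_ge_le (ord_ge_deriv i og).
  by rewrite ltnS leq_mul2l leq_addr orbT.
have U : 1 + b * f \is a GRing.unit.
  rewrite cps_unitE -[cps_val _ _]/((mnm0 == mnm0)%:R + cps_val (b * f) mnm0).
  by rewrite cps_coef0M f0 mulr0 addr0 eqxx oner_neq0.
have {}IM : I (1 * f ^+ M) by rewrite mul1r -(mulrK U (f ^+ M)); apply: idealMr.
exists (k * M)%N => j; rewrite exprM -[_ ^+ M]mul1r.
exact: ideal_add_exp IM.
Qed.

End FiniteCodimension.

Section Truncation.
Variables (K : fieldType) (n : nat).
Implicit Types (p : mpoly n K).

Lemma deg_lt_trunc d (g : fps K n) : deg_lt d (fps_trunc d g).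
Proof.
move=> m dm; rewrite raddf_sum big1// => -[k kd] _ /=.
rewrite mcoeffZ mcoeffX; case: eqP => [km|]; last by rewrite mulr0.
by move: kd; rewrite km ltnNge dm.
Qed.

Lemma poly_ord_ge_ideal_span k p : ord_ge (n * k).+1 (fps_poly p) ->
  ideal_span (fun j => xvar j ^+ k) p.
Proof.
move=> pk; have id := ideal_span_ideal (fun j : 'I_n => mpolyX K (mnm1 j) ^+ k).
rewrite (mpolyE p) big_seq; apply: ideal_sum => // m; rewrite mcoeff_msupp => pm.
rewrite -mul_mpolyC; apply: idealMl => //.
have [j kj] : exists j, (k <= m j)%N.
  apply/existsP; apply: contraNT pm => /existsPn mk; apply/eqP/pk.
  rewrite ltnS mdegE mulnC -[X in (_ <= _ * X)%N](card_ord n) mulnC -sum_nat_const.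
  by apply: leq_sum => j _; rewrite ltnW// ltnNge mk.
rewrite -(submK (m := mnm_muln (mnm1 j) k) (m' := m)) ?mpolyXD -?mpolyXn.
  by apply: idealMl => //; exact: ideal_span_gen.
apply/mnm_lepP => l; rewrite mulmnE mnm1E.
by case: eqP => [<-|]; rewrite ?mul1n ?mul0n.
Qed.

(** The value at [x = s = 0]; the elements where it is nonzero form the multiplicative set used to
    localize [K[s][x]]. *)
Definition const_coef (g : mpoly n {poly K}) : K := (mcoeff mnm0 g).[0].

HB.instance Definition _ := GRing.RMorphism.copy const_coef
  (horner_eval 0 \o (@mcoeff n {poly K} mnm0)).

Lemma const_coef_spec g : mcoeff mnm0 (spec 0 g) = const_coef g.
Proof. exact: mcoeff_map_mpoly. Qed.

Lemma const_coefX j : const_coef (xvar j) = 0.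
Proof. by rewrite /const_coef mcoeffX mnm1_eq0 horner0. Qed.

End Truncation.

(** * The polynomial family joining the two Jacobian ideals *)

Section Deformation.
Variables (R : realType) (K : fieldType) (v : absval R K) (n : nat).
Local Notation A := (cps v n).
Local Notation P := (mpoly n {poly K}).
Local Notation x_ := (cps_var v (n := n)).
Local Notation poly := (cps_poly v (n := n)).
Hypothesis K0 : [pchar K] =i pred0.
Variables (f : A) (w : 'I_n -> A) (k0 k1 : nat).
Hypothesis f0 : cps_val f mnm0 = 0.
Hypothesis Jx : forall j, jacobian_ideal f (x_ j ^+ k0).
Let a i := cps_deriv i f + w i * f.
Hypothesis ax : forall j, ideal_span a (x_ j ^+ k1).

(** Series of order [N] lie in the ideal of the [x_j^(k0+1)] and in that of the [x_j^(k1+1)]; the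
    spare factor [x_j] serves the Nakayama arguments. *)
Let N := (n * (k0 + k1).+1).+1.
(** The added terms have partial derivatives [x_l^N], which gives [at_] the leading forms required
    by [normal_form]. *)
Let fh : mpoly n K := fps_trunc N.+1 f + \sum_l (N.+1)%:R^-1 *: xvar l ^+ N.+1.
Let tau i : mpoly n K := fps_trunc N (w i * f).
Let at_ i : P := lift_const (mderiv i fh) + 'X *: lift_const (tau i).

Let mderiv_fh i : mderiv i fh = mderiv i (fps_trunc N.+1 f) + xvar i ^+ N.
Proof.
rewrite /fh mderivD; congr (_ + _); rewrite raddf_sum.
rewrite (bigD1 i)//= big1 ?addr0 => [|j ji].
  rewrite mderivZ mpolyXn mderivX scalerA mulmnE mnm1E eqxx mul1n mulVf; last first.
    by rewrite ((pcharf0P K).1 K0).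
  rewrite scale1r mpolyXn; congr mpolyX; apply/mnmP => l.
  by rewrite mnmBE !mulmnE mnm1E; case: eqP => _; rewrite ?mul1n ?mul0n// subn1.
rewrite /= mderivZ mpolyXn mderivX mulmnE mnm1E (negbTE ji) mul0n.
by rewrite !(scale0r, scaler0).
Qed.

Let at_top i : deg_lt N (at_ i - xvar i ^+ N).
Proof.
have -> : at_ i - xvar i ^+ N =
    lift_const (mderiv i (fps_trunc N.+1 f)) + 'X *: lift_const (tau i).
  rewrite /at_ mderiv_fh rmorphD rmorphXn/= [lift_const (xvar i)]map_mpolyX.
  ring.
move=> m Nm; rewrite mcoeffD mcoeffZ !mcoeff_map_mpoly mcoeff_deriv.
rewrite !(@deg_lt_trunc _ _ _ _ _ _)//= ?mul0rn ?rmorph0 ?mulr0 ?addr0//.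
by rewrite mdegD mdeg1 addn1.
Qed.

Let cps_derivB i g h : cps_deriv i (g - h) = cps_deriv i g - cps_deriv i h :> A.
Proof. by have := cps_derivD i (g - h) h; rewrite subrK => ->; rewrite addrK. Qed.

Let trunc_ord d (g : A) : ord_ge d (g - poly (fps_trunc d g)).
Proof. exact: ord_ge_trunc. Qed.

Let ord_fh : ord_ge N.+1 (f - poly fh).
Proof.
rewrite /fh rmorphD/= opprD addrA; apply: ord_geD; first exact: trunc_ord.
have : ord_ge N.+1 (poly (- \sum_l (N.+1)%:R^-1 *: xvar l ^+ N.+1)).
  move=> m mN; rewrite /= /fps_poly mcoeffN raddf_sum big1 ?oppr0// => l _ /=.
  rewrite mcoeffZ mpolyXn mcoeffX; case: eqP => [E|]; last by rewrite mulr0.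
  by move: mN; rewrite -E mdegMn mdeg1 mul1n ltnn.
by rewrite rmorphN.
Qed.

Let ord_deriv_fh i : ord_ge N (cps_deriv i f - poly (mderiv i fh)).
Proof.
by rewrite -cps_deriv_poly -cps_derivB; apply: ord_ge_deriv ord_fh.
Qed.

Let ord_mul0l k (g h : A) : ord_ge k h -> ord_ge k (g * h).
Proof. by move=> hk; rewrite -[k]add0n; apply: cps_ord_geM. Qed.

Let ord_mul0r k (g h : A) : ord_ge k g -> ord_ge k (g * h).
Proof. by move=> gk; rewrite mulrC; apply: ord_mul0l. Qed.

Let idJ := jacobian_ideal_ideal f.
Let ida := ideal_span_ideal a.
Let idat := ideal_span_ideal at_.

Let ord_J (g : A) : ord_ge N g -> jacobian_ideal f g.
Proof.
move=> gN; apply: ord_ge_mem Jx _ => //; apply: ord_ge_le gN.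
by rewrite /N ltnS leq_mul2l (leq_trans (leq_addr k1 k0)) ?orbT.
Qed.

(** At [s = 0], [at_ i] agrees with [f_i] up to terms of order [N], which lie in the Jacobian
    ideal. *)
Let poly_at0 g : ideal_span (spec 0 \o at_) g -> jacobian_ideal f (poly g).
Proof.
move=> [t ->]; rewrite rmorph_sum; apply: ideal_sum => // i _.
rewrite rmorphM; apply: idealMl => //=.
have -> : spec 0 (at_ i) = mderiv i fh.
  rewrite rmorphD/= [spec 0 ('X *: _)]map_mpolyZ [X in X *: _]hornerX scale0r.
  by rewrite addr0; apply: lift_constK.
rewrite -[poly _](subKr (cps_deriv i f)); apply: idealB => //.
  exact: ideal_span_gen.
exact/ord_J/ord_deriv_fh.
Qed.

Let spec1_at i : spec 1 (at_ i) = mderiv i fh + tau i.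
Proof.
rewrite rmorphD/= [spec 1 ('X *: _)]map_mpolyZ [X in X *: _]hornerX scale1r.
by congr (_ + _); apply: lift_constK.
Qed.

Let ord_at1 i : ord_ge N (a i - poly (spec 1 (at_ i))).
Proof.
rewrite spec1_at /a [poly (_ + _)]rmorphD opprD addrACA.
apply: ord_geD; first exact: ord_deriv_fh.
exact: trunc_ord.
Qed.

(** Nakayama's lemma: [a i - b i] is a combination of the [x_j * x_j^k1], hence of the [a l] with
    coefficients in the maximal ideal. So [b = M a] with [M] the identity at the origin, and
    [\det M] is a unit. *)
Let at1_a j : ideal_span (fun i => poly (spec 1 (at_ i))) (a j).
Proof.
set b := fun i => _; have idb := ideal_span_ideal b.
have /choice[z zE] i : exists z, a i - b i = \sum_j z j * x_ j ^+ k1.+1.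
  have [|z ->] := @ord_ge_ideal_span _ _ v n k1.+1 (a i - b i); last by exists z.
  apply: ord_ge_le (ord_at1 i); rewrite /N ltnS leq_mul2l ltnS leq_addl.
  by rewrite orbT.
have [t tE] := choice ax.
pose M : 'M[A]_n := \matrix_(i, l) ((i == l)%:R - \sum_j z i j * x_ j * t j l).
have ME i : \sum_l M i l * a l = b i.
  under eq_bigr do rewrite mxE mulrBl; rewrite sumrB.
  rewrite (bigD1 i)//= eqxx mul1r big1 ?addr0 => [|l li]; last first.
    by rewrite eq_sym (negbTE li) mul0r.
  have -> : \sum_l (\sum_j z i j * x_ j * t j l) * a l = a i - b i.
    rewrite zE; under eq_bigr do rewrite mulr_suml; rewrite exchange_big.
    apply: eq_bigr => j' _ /=; under eq_bigr do rewrite -mulrA.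
    by rewrite -mulr_sumr -tE -mulrA -exprS.
  by rewrite subKr.
have bM : ideal_span b (\det M * a j).
  by apply: ideal_det => // i; rewrite ME; exact: ideal_span_gen.
have U : \det M \is a GRing.unit.
  rewrite cps_unitE -[cps_val _ _]/(cps_coef0 _) -det_map_mx.
  rewrite (_ : map_mx _ _ = 1%:M) ?det1 ?oner_neq0//.
  apply/matrixP => i l; rewrite !mxE rmorphB rmorph_nat rmorph_sum big1 ?subr0//.
  by move=> j' _; rewrite !rmorphM [X in _ * X * _]cps_coef0X mulr0 mul0r.
by rewrite -(mulKr U (a j)); apply: idealMl.
Qed.

Let W i := fps_trunc N (w i).

Let N0 : ((n * k0.+1).+1 <= N)%N.
Proof. by rewrite /N ltnS leq_mul2l ltnS leq_addr orbT. Qed.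

(** Both [tau i] and [W i * fh] agree with [w i * f] up to order [N]. *)
Let tau_split i : exists E, tau i - W i * fh = \sum_l E l * xvar l ^+ k0.+1.
Proof.
have [|E ->] := @poly_ord_ge_ideal_span _ n k0.+1 (tau i - W i * fh); last by exists E.
rewrite -[fps_poly _]/(cps_val (poly _)); apply: ord_ge_le N0 _.
have -> : poly (tau i - W i * fh) = (w i - poly (W i)) * f
    + (poly (W i) * (f - poly fh) + (-1) * (w i * f - poly (tau i))).
  by rewrite rmorphB rmorphM; ring.
apply: ord_geD; first exact/ord_mul0r/trunc_ord.
apply: ord_geD; last exact/ord_mul0l/trunc_ord.
by apply/ord_mul0l; apply: ord_ge_le ord_fh.
Qed.

(** Nakayama over [K[s][x]]: modulo [at_] and [fh], each [x_j^k0] is a combination of the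
    [x_l * x_l^k0]. The resulting matrix [M] is the identity at the origin, and [Q] is its
    determinant. *)
Let local_unit : exists Q, const_coef Q = 1 /\
  forall j, ideal_add (ideal_span at_) (lift_const fh) (Q * xvar j ^+ k0).
Proof.
have idF := ideal_add_ideal (lift_const fh) idat.
have [t tE] := choice Jx.
pose T j i := fps_trunc N (t j i).
have /choice[D DE] j : exists D, xvar j ^+ k0 - \sum_i T j i * mderiv i fh =
    \sum_l D l * xvar l ^+ k0.+1.
  have [|D ->] := @poly_ord_ge_ideal_span _ n k0.+1
    (xvar j ^+ k0 - \sum_i T j i * mderiv i fh); last by exists D.
  rewrite -[fps_poly _]/(cps_val (poly _)); apply: ord_ge_le N0 _.
  have -> : poly (xvar j ^+ k0 - \sum_i T j i * mderiv i fh) =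
      \sum_i (t j i * cps_deriv i f - poly (T j i * mderiv i fh)).
    by rewrite sumrB -tE rmorphB rmorphXn (rmorph_sum poly).
  apply: cps_ord_ge_sum => i _.
  have -> : t j i * cps_deriv i f - poly (T j i * mderiv i fh) =
      (t j i - poly (T j i)) * cps_deriv i f
      + poly (T j i) * (cps_deriv i f - poly (mderiv i fh)) by rewrite rmorphM; ring.
  by apply: ord_geD; [apply/ord_mul0r/trunc_ord|apply/ord_mul0l/ord_deriv_fh].
have [E EE] := choice tau_split.
pose L : mpoly n K -> P := @lift_const K n.
pose M : 'M[P]_n := \matrix_(j, l) ((j == l)%:R -
  (L (D j l) - 'X *: L (\sum_i T j i * E i l)) * xvar l).
exists (\det M); split.
  rewrite -det_map_mx (_ : map_mx _ _ = 1%:M) ?det1//.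
  apply/matrixP => j l; rewrite !mxE rmorphB rmorph_nat rmorphM/=.
  by rewrite const_coefX mulr0 subr0.
apply: ideal_det => // j.
have -> : \sum_l M j l * xvar l ^+ k0 =
    \sum_i L (T j i) * at_ i - ('X *: L (\sum_i T j i * W i)) * lift_const fh.
  under eq_bigr do rewrite mxE mulrBl; rewrite sumrB.
  rewrite (bigD1 j)//= eqxx mul1r big1 ?addr0 => [|l lj]; last first.
    by rewrite eq_sym (negbTE lj) mul0r.
  have LX l k : L (xvar l ^+ k) = xvar l ^+ k.
    by rewrite /L rmorphXn/= [lift_const _]map_mpolyX.
  have -> : \sum_l (L (D j l) - 'X *: L (\sum_i T j i * E i l)) * xvar l * xvar l ^+ k0
      = L (xvar j ^+ k0 - \sum_i T j i * mderiv i fh)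
        - 'X *: L (\sum_i T j i * (tau i - W i * fh)).
    rewrite DE; under [X in _ = _ - _ *: L X]eq_bigr do rewrite EE mulr_sumr.
    rewrite [in X in _ = _ - _ *: L X]exchange_big/= /L.
    rewrite !rmorph_sum scaler_sumr -sumrB; apply: eq_bigr => l _ /=.
    rewrite -mulrA -exprS mulrBl rmorphM/= -/L LX; congr (_ - _).
    rewrite -scalerAl -LX -rmorphM mulr_suml; congr (_ *: L _).
    by apply: eq_bigr => i _; rewrite mulrA.
  pose S1 := \sum_i T j i * mderiv i fh; pose S2 := \sum_i T j i * tau i.
  pose S3 := \sum_i T j i * W i; rewrite -/S1 -/S3.
  have -> : \sum_i T j i * (tau i - W i * fh) = S2 - S3 * fh.
    rewrite /S2 /S3 mulr_suml -sumrB; apply: eq_bigr => i _.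
    by rewrite mulrBr mulrA.
  have -> : \sum_i L (T j i) * at_ i = L S1 + 'X *: L S2.
    rewrite /S1 /S2 /L !rmorph_sum scaler_sumr -big_split; apply: eq_bigr => i _ /=.
    by rewrite !rmorphM/= mulrDr -scalerAr.
  rewrite /L !rmorphB rmorphM/= -/L LX -!mul_mpolyC; ring.
apply: idealB => //; last by apply: idealMl => //; exact: ideal_add_gen.
apply: ideal_sum => // i _; apply: idealMl => //; apply: ideal_add_sub => //.
exact: ideal_span_gen.
Qed.

(** The argument of [deformed_jacobian_var_exp] over [K[s]], localized at [x = s = 0]: a power of
    [fh] times an element of [S] lies in the ideal, and [local_unit] passes from [fh] to the
    [x_j^k0]. *)
Lemma saturated_var_exp : exists Q k, const_coef Q != 0 /\
  forall j, ideal_span at_ (Q * xvar j ^+ k).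
Proof.
have [D [b [nf [nf_linear nf_at nf_b nf_span]]]] := normal_form (ltn0Sn _) at_top.
pose S (q : P) := const_coef q != 0.
have S1 : S 1 by rewrite /S rmorph1 oner_neq0.
have SM q q' : S q -> S q' -> S (q * q').
  by rewrite /S rmorphM mulf_eq0 negb_or => -> ->.
pose I := ideal_span at_; pose F := lift_const fh.
have id1 := sat_ideal_ideal F S1 SM idat 1.
have [q0 [q01 q0x]] := local_unit.
have Sq0 : S q0 by rewrite /S q01 oner_neq0.
have I1x j : sat_ideal S I F 1 (xvar j ^+ k0).
  by apply: (sat_idealS SM Sq0); apply: ideal_add_sat.
have [r [e se]] := sat_ideal_finite_codim nf_span F S1 SM.
have FE p : mmap (@mpolyC n {poly K} \o polyC) (fun i => xvar i) p = lift_const p.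
  by rewrite /lift_const /map_mpoly; apply: eq_bigr.
have [q [M [c [Sq IM]]]] : exists q M c, S q /\ I (F ^+ M * (q + c * F)).
  apply: (saturation_unit S1 SM idat se (x := fun i => xvar i) (p := fh) K0).
    rewrite FE subrr; apply: ideal0; exact: sat_ideal_ideal.
  move=> i; rewrite FE.
  have -> : lift_const (mderiv i fh) = at_ i - 'X *: lift_const
      (tau i - W i * fh) - ('X *: lift_const (W i)) * F.
    by rewrite /at_ /F rmorphB rmorphM/= -!mul_mpolyC; ring.
  apply: idealB => //; last by apply: idealMl => //; exact: sat_ideal_gen.
  apply: idealB => //; first exact/sat_ideal_sub/ideal_span_gen.
  rewrite -mul_mpolyC; apply: idealMl => //; have [E ->] := tau_split i.
  rewrite rmorph_sum; apply: ideal_sum => // l _.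
  rewrite exprS mulrA /= rmorphM rmorphXn/= [lift_const (xvar l)]map_mpolyX.
  exact: idealMl.
(* [fh] vanishes at the origin like [f], so adding a multiple of [F] keeps [q] in [S]. *)
have Sq' : const_coef (q + c * F) != 0.
  rewrite rmorphD rmorphM/=.
  have -> : const_coef F = 0.
    rewrite -const_coef_spec [spec 0 F]lift_constK.
    apply/eqP; rewrite -oppr_eq0; apply/eqP.
    have := ord_fh (m := mnm0); rewrite mdeg0 => /(_ isT).
    by rewrite -[LHS]/(cps_val f mnm0 - mcoeff mnm0 fh) f0 sub0r.
  by rewrite mulr0 addr0.
exists ((q + c * F) * q0 ^+ M), (k0 * M)%N; split=> [|j].
  rewrite rmorphM rmorphXn/= q01 expr1n mulr1.
  exact: Sq'.
rewrite exprM -mulrA -exprMn; apply: ideal_add_exp (q0x j) _ => //.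
by rewrite mulrC.
Qed.

(** An application of [codim_leq] between [s = 0] and [s = 1] to truncations of [e0] and [e1]. At
    [s = 0], [Q] becomes a unit of [K{x}], so freeness survives multiplication by it. *)
Lemma deformed_codim_leq d0 d1 (e0 : 'I_d0 -> A) (e1 : 'I_d1 -> A) :
  free_mod (in_alg A) (jacobian_ideal f) e0 ->
  spans_mod (in_alg A) (ideal_span a) e1 -> (d0 <= d1)%N.
Proof.
move=> free0 span1.
have [D [b [nf [nf_linear nf_at nf_b nf_span]]]] := normal_form (ltn0Sn _) at_top.
have [Q [k [Q0 Qx]]] := saturated_var_exp.
pose t0 i := fps_trunc N (e0 i); pose t1 i := fps_trunc N (e1 i).
have polyZ c p : poly (c *: p) = in_alg A c * poly p.
  by rewrite cps_polyZ mulr_algl.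
apply: (@codim_leq _ _ _ _ _ _ nf_linear nf_at nf_b nf_span 0 1 Q k d0 d1 t0 t1 Qx).
  move=> c /poly_at0; rewrite rmorphM => JQ; apply: free0.
  have U : poly (spec 0 Q) \is a GRing.unit.
    by rewrite cps_unitE /= /fps_poly const_coef_spec.
  have {JQ} : jacobian_ideal f (poly (\sum_i c i *: t0 i)).
    by rewrite -(mulKr U (poly _)); apply: idealMl.
  apply: ideal_eq => //; rewrite rmorph_sum -sumrB; apply: ideal_sum => // i _.
  rewrite /= polyZ -mulrBr; apply: idealMl => //.
  exact/ord_J/trunc_ord.
move=> g; have [c Jc] := span1 (poly g).
have [h hE] : ideal_span (fun i => poly (spec 1 (at_ i)))
    (poly g - \sum_i in_alg A (c i) * poly (t1 i)).
  apply: (ideal_sub_trans (ideal_span_ideal _)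
    (h := \sum_i in_alg A (c i) * e1 i)).
    by apply: ideal_span_sub Jc => [|i]; [exact: ideal_span_ideal|exact: at1_a].
  rewrite -sumrB; apply: ideal_sum => [|i _]; first exact: ideal_span_ideal.
  rewrite -mulrBr; apply: idealMl; first exact: ideal_span_ideal.
  apply: (@ideal_span_sub _ _ a _ (ideal_span_ideal _) at1_a).
  apply: (ord_ge_mem ida ax).
  apply: (@ord_ge_le _ _ N _ (cps_val (e1 i - poly (t1 i)))); last exact: trunc_ord.
  by rewrite /N ltnS leq_mul2l (leq_trans (leq_addl k0 k1)) ?orbT.
(* Truncating the coefficients [h i] leaves an error of order above [n * k], which lies in the ideal
   of the [x_i^k]; so the relation becomes polynomial. *)
pose H i := fps_trunc (n * k).+1 (h i).
have [z zE] : ideal_span (fun i => xvar i ^+ k)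
    (g - \sum_i c i *: t1 i - \sum_i H i * spec 1 (at_ i)).
  apply: poly_ord_ge_ideal_span; rewrite -[fps_poly _]/(cps_val (poly _)).
  have -> : poly (g - \sum_i c i *: t1 i - \sum_i H i * spec 1 (at_ i)) =
      \sum_i (h i - poly (H i)) * poly (spec 1 (at_ i)).
    rewrite 2!rmorphB (rmorph_sum poly) (rmorph_sum poly).
    under eq_bigr do rewrite /= polyZ.
    rewrite hE -sumrB; apply: eq_bigr => i _.
    by rewrite rmorphM mulrBl.
  by apply: cps_ord_ge_sum => i _; apply/ord_mul0r/trunc_ord.
exists c, H, z; rewrite -zE; ring.
Qed.

End Deformation.

(** * Invariance under multiplication by a unit *)

Section UnitFactor.
Variables (R : realType) (K : fieldType) (v : absval R K) (n : nat).
Local Notation A := (cps v n).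
Hypothesis K0 : [pchar K] =i pred0.

Lemma jacobian_ideal_unit (f u : A) h : u \is a GRing.unit ->
  jacobian_ideal (u * f) h <->
  ideal_span (fun i => cps_deriv i f + u^-1 * cps_deriv i u * f) h.
Proof.
move=> uU; pose a i := cps_deriv i f + u^-1 * cps_deriv i u * f.
have E i : cps_deriv i (u * f) = u * a i.
  by rewrite cps_derivM /a mulrDr !mulrA divrr// mul1r addrC.
have idf := jacobian_ideal_ideal (u * f); have ida := ideal_span_ideal a.
split; [apply: (ideal_span_sub ida) => i|apply: (ideal_span_sub idf) => i].
  by rewrite E; apply: (idealMl ida); exact: (ideal_span_gen a).
rewrite -/(a i) -(mulKr uU (a i)) -E.
by apply: (idealMl idf); exact: (ideal_span_gen (fun i => cps_deriv i (u * f))).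
Qed.

Lemma milnor_basis_unit_leq (f u : A) d : cps_val f mnm0 = 0 ->
  u \is a GRing.unit -> milnor_basis f d ->
  exists2 e, milnor_basis (u * f) e & (d <= e)%N.
Proof.
move=> f0 uU [b [sb fb]].
have [k Jx] := var_exp_of_finite_codim (jacobian_ideal_ideal f) sb.
pose w i := u^-1 * cps_deriv i u.
have [l ax] := deformed_jacobian_var_exp K0 w f0 Jx.
have [r [e se]] := finite_codim_of_var_exp (ideal_span_ideal _) ax.
have [d1 [e1 [se1 fe1]]] := exists_basis_mod (ideal_span_ideal _) se.
exists d1; last exact: (deformed_codim_leq K0 f0 Jx ax fb se1).
exists e1; split=> [h|c /(jacobian_ideal_unit _ _ uU)/fe1//].
by have [c Ic] := se1 h; exists c; apply/(jacobian_ideal_unit _ _ uU).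
Qed.

(** The one-sided inequality applied to [f] with [u] and to [u * f] with [u^-1]; it also transfers
    finiteness, so infinite values agree as well. *)
Lemma milnor_number_unit (f u : A) : cps_val f mnm0 = 0 -> u \is a GRing.unit ->
  milnor_number (u * f) = milnor_number f.
Proof.
move=> f0 uU.
have uf0 : cps_val (u * f) mnm0 = 0 by rewrite cps_coef0M f0 mulr0.
have uVU : u^-1 \is a GRing.unit by rewrite unitrV.
have leq1 d : milnor_basis f d ->
    exists2 e, milnor_basis (u * f) e & (d <= e)%N.
  exact: milnor_basis_unit_leq.
have leq2 d : milnor_basis (u * f) d -> exists2 e, milnor_basis f e & (d <= e)%N.
  by move=> /(milnor_basis_unit_leq uf0 uVU); rewrite mulKr.
apply: milnor_number_eq => d.
split=> [/[dup] ufd /leq2[e fe de]|/[dup] fd /leq1[e ufe de]].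
  have [d' ufd' ed'] := leq1 _ fe; suff -> : d = e by [].
  by apply/eqP; rewrite eqn_leq de (leq_trans ed' (milnor_basis_leq ufd' ufd)).
have [d' fd' ed'] := leq2 _ ufe; suff -> : d = e by [].
by apply/eqP; rewrite eqn_leq de (leq_trans ed' (milnor_basis_leq fd' fd)).
Qed.

End UnitFactor.

(* f is required to vanish at the origin (then so does g): for n = 1 the unit
   1 + x is contact equivalent to 1, and mu (1 + x) = 0 while mu 1 is infinite. *)
Theorem proposition1p4 (R : realType) (K : fieldType) (v : absval R K)
    (n : nat) (f g : cps v n) :
  [pchar K] =i pred0 ->
  cps_val f mnm0 = 0 ->
  contact_equivalent f g ->
  milnor_number f = milnor_number g.
Proof.
move=> K0 f0 [phi [u [bphi uU fE]]].
rewrite fE milnor_number_unit ?milnor_number_lrmorphism//.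
(* [milnor_number_unit] needs [phi g] to vanish at the origin: [u * phi g] does, and [u] is a
   unit. *)
have : cps_val u mnm0 * cps_val (phi g) mnm0 = 0 by rewrite -cps_coef0M -fE.
by move/eqP; rewrite mulf_eq0 -[_ == 0]negbK -cps_unitE uU /= => /eqP.
Qed.
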